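(* Let $\Lambda$ and $\Gamma$ be left and right noetherian rings and let ${}_{\Lambda}U_{\Gamma}$ be a faithfully balanced selforthogonal bimodule with ${}_{\Lambda}U$ and $U_{\Gamma}$ finitely generated. For a positive integer $k$, the following statements are equivalent. (1) $\mathrm{grade}_U\mathrm{Ext}^{i+1}_{\Lambda}(M,U)\geq i$ for any $M\in\mathrm{mod}\,\Lambda$ and $1\leq i\leq k-1$. (2) $\mathrm{Ext}^{i-1}_{\Gamma}(\mathrm{Ext}^{i+1}_{\Lambda}(M,U),U)=0$ for any $M\in\mathrm{mod}\,\Lambda$ and $1\leq i\leq k-1$. (1)$^{op}$ $\mathrm{grade}_U\mathrm{Ext}^{i+1}_{\Gamma}(N,U)\geq i$ for any $N\in\mathrm{mod}\,\Gamma^{op}$ and $1\leq i\leq k-1$. (2)$^{op}$ $\mathrm{Ext}^{i-1}_{\Lambda}(\mathrm{Ext}^{i+1}_{\Gamma}(N,U),U)=0$ for any $N\in\mathrm{mod}\,\Gamma^{op}$ and $1\leq i\leq k-1$.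
   Context: $\mathrm{mod}\,\Lambda$ is the category of finitely generated left $\Lambda$-modules and $\mathrm{mod}\,\Gamma^{op}$ the category of finitely generated right $\Gamma$-modules. For $M\in\mathrm{mod}\,\Lambda$, $\mathrm{Ext}^i_{\Lambda}(M,U)$ is a right $\Gamma$-module; for $N\in\mathrm{mod}\,\Gamma^{op}$, $\mathrm{Ext}^i_{\Gamma}(N,U)$ is a left $\Lambda$-module; $\mathrm{Ext}^0=\mathrm{Hom}$. ${}_{\Lambda}U_{\Gamma}$ is faithfully balanced if the natural maps $\Lambda\to\mathrm{End}(U_{\Gamma})$ and $\Gamma\to\mathrm{End}({}_{\Lambda}U)^{op}$ are isomorphisms; it is selforthogonal if $\mathrm{Ext}^i_{\Lambda}({}_{\Lambda}U,{}_{\Lambda}U)=0$ and $\mathrm{Ext}^i_{\Gamma}(U_{\Gamma},U_{\Gamma})=0$ for all $i\geq 1$. For $A$ in $\mathrm{mod}\,\Lambda$ (resp. $\mathrm{mod}\,\Gamma^{op}$), $\mathrm{grade}_U A\geq i$ means $\mathrm{Ext}^j_{\Lambda}(A,U)=0$ (resp. $\mathrm{Ext}^j_{\Gamma}(A,U)=0$) for all $0\leq j<i$. *)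

(* Defs.v *)
From HB Require Import structures.
From mathcomp Require Import all_boot all_algebra.
From mathcomp Require Import ring_quotient.
From mathcomp Require Import boolp classical_sets functions cardinality fsbigop.

Set Implicit Arguments.
Unset Strict Implicit.
Unset Printing Implicit Defensive.

Import GRing.Theory.
Local Open Scope ring_scope.
Local Open Scope quotient_scope.

(* Rings are unital, associative and possibly zero (pzRingType). A left       *)
(* R-module is an lmodType R; a right R-module is an lmodType R^c, where R^c  *)
(* is the converse (opposite) ring of R.                                      *)

Record submodule (R : pzRingType) (V : lmodType R) := Submodule {
  submodule_pred :> {pred V};
  submoduleP : submod_closed submodule_pred
}.

HB.instance Definition _ (R : pzRingType) (V : lmodType R) (I : submodule V) :=
  GRing.isSubmodClosed.Build R V (submodule_pred I) (submoduleP I).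

Section SubQuotient.
Variables (R : pzRingType) (V : lmodType R) (I : submodule V).

Definition submod : Type := {x : V | x \in submodule_pred I}.

HB.instance Definition _ := SubChoice.on submod.
HB.instance Definition _ := [SubChoice_isSubLmodule of submod by <:].

Definition quotmod : Type := Quotient.quot (submodule_pred I).

HB.instance Definition _ := EqQuotient.on quotmod.
HB.instance Definition _ := GRing.Zmodule.on quotmod.

Definition qpi (x : V) : quotmod := \pi_(Quotient.quot (submodule_pred I)) x.

Definition qscale (a : R) (q : quotmod) : quotmod := qpi (a *: repr q).

Lemma qpi_eq x y : (qpi x = qpi y) <-> (x - y \in submodule_pred I).
Proof.
rewrite /qpi; split=> [/eqP|].
  by rewrite -Quotient.idealrBE.
by rewrite Quotient.idealrBE => /eqP.
Qed.

Lemma qpi_repr q : qpi (repr q) = q.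
Proof. exact: reprK. Qed.

Lemma qpiD x y : qpi (x + y) = qpi x + qpi y.
Proof. exact: Quotient.pi_add. Qed.

Lemma qscale_pi a x : qscale a (qpi x) = qpi (a *: x).
Proof. by apply/qpi_eq; rewrite -scalerBr rpredZ //; apply/qpi_eq/qpi_repr. Qed.

Let qscaleA a b q : qscale a (qscale b q) = qscale (a * b) q.
Proof. by rewrite -[q]qpi_repr !qscale_pi scalerA. Qed.

Let qscale1 : left_id 1 qscale.
Proof. by move=> q; rewrite -[q]qpi_repr qscale_pi scale1r. Qed.

Let qscaleDr : right_distributive qscale +%R.
Proof.
move=> a p q; rewrite -[p]qpi_repr -[q]qpi_repr.
by rewrite -qpiD !qscale_pi scalerDr qpiD.
Qed.

Let qscaleDl q : {morph qscale^~ q : a b / a + b}.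
Proof. by move=> a b; rewrite -[q]qpi_repr !qscale_pi scalerDl qpiD. Qed.

HB.instance Definition _ := GRing.Zmodule_isLmodule.Build R quotmod
  qscaleA qscale1 qscaleDr qscaleDl.

End SubQuotient.

Section Homology.
Variables (R : pzRingType) (A B C : lmodType R).
Variables (f : {linear A -> B}) (g : {linear B -> C}).

Definition ker_pred : {pred B} := fun x => g x == 0.

Lemma ker_closed : submod_closed ker_pred.
Proof.
split=> [|a x y]; first by rewrite unfold_in /= raddf0.
by rewrite !unfold_in => /eqP gx /eqP gy; rewrite linearP gx gy scaler0 addr0.
Qed.

Definition kernel : submodule B := Submodule ker_closed.

Definition boundary_pred : {pred submod kernel} :=
  fun z => `[< exists a, f a = val z >].

Lemma boundary_closed : submod_closed boundary_pred.
Proof.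
split=> [|a x y]; first by apply/asboolP; exists 0; rewrite !raddf0.
move=> /asboolP[u fu] /asboolP[v fv]; apply/asboolP; exists (a *: u + v).
by rewrite !linearP fu fv.
Qed.

(* ker g modulo (im f :&: ker g); in a complex this is ker g / im f *)
Definition homology : lmodType R := quotmod (Submodule boundary_closed).

End Homology.

(* An abelian group with commuting left actions of R and S. Thus a            *)
(* Lambda-Gamma-bimodule (Lambda on the left, Gamma on the right) is a        *)
(* bimodule Lambda Gamma^c.                                                   *)
Record bimodule (R S : pzRingType) := Bimodule {
  bisort : zmodType;
  lact : R -> bisort -> bisort;
  ract : S -> bisort -> bisort;
  lactA : forall a b u, lact a (lact b u) = lact (a * b) u;
  lact1 : left_id 1 lact;
  lactDr : right_distributive lact +%R;
  lactDl : forall u, {morph lact^~ u : a b / a + b};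
  ractA : forall a b u, ract a (ract b u) = ract (a * b) u;
  ract1 : left_id 1 ract;
  ractDr : right_distributive ract +%R;
  ractDl : forall u, {morph ract^~ u : a b / a + b};
  lractC : forall a b u, lact a (ract b u) = ract b (lact a u)
}.

Definition swap (R S : pzRingType) (U : bimodule R S) : bimodule S R :=
  Bimodule (@ractA R S U) (@ract1 R S U) (@ractDr R S U) (@ractDl R S U)
    (@lactA R S U) (@lact1 R S U) (@lactDr R S U) (@lactDl R S U)
    (fun b a u => esym (lractC a b u)).

Definition lside_sort (R S : pzRingType) (U : bimodule R S) : Type := bisort U.

HB.instance Definition _ (R S : pzRingType) (U : bimodule R S) :=
  GRing.Zmodule.on (lside_sort U).
HB.instance Definition _ (R S : pzRingType) (U : bimodule R S) :=
  GRing.Zmodule_isLmodule.Build R (lside_sort U)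
    (@lactA R S U) (@lact1 R S U) (@lactDr R S U) (@lactDl R S U).

Definition lside (R S : pzRingType) (U : bimodule R S) : lmodType R :=
  lside_sort U.
Definition rside (R S : pzRingType) (U : bimodule R S) : lmodType S :=
  lside (swap U).

(* Hom_R(M, U), with (s f)(m) = s (f m) *)
Section Hom.
Variables (R S : pzRingType) (U : bimodule R S).

Section Def.
Variable M : lmodType R.

Definition hom_pred : {pred M -> rside U} :=
  fun f => `[< linear (f : M -> lside U) >].

Lemma hom_closed : submod_closed hom_pred.
Proof.
split=> [|s f g]; first by apply/asboolP => a x y; rewrite scaler0 addr0.
move=> /asboolP lf /asboolP lg; apply/asboolP => a x y.
have E z : (s *: f + g) z = (s *: f z + g z) by [].
rewrite !E lf lg.
have -> : a *: (s *: f x + g x : lside U) =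
          s *: (a *: (f x : lside U) : rside U) + a *: (g x : lside U).
  by rewrite scalerDr; congr (_ + _); exact: lractC.
by rewrite scalerDr -!addrA; congr (_ + _); rewrite addrCA.
Qed.

Definition hom_submodule : submodule (M -> rside U) := Submodule hom_closed.

Definition Hom : lmodType S := submod hom_submodule.

End Def.

Variables (M N : lmodType R) (g : {linear N -> M}).

Lemma precomp_subproof (f : Hom M) : hom_pred (fun x => val f (g x)).
Proof.
have /asboolP lf := valP f; apply/asboolP => a x y.
by rewrite linearP lf.
Qed.

Definition precomp (f : Hom M) : Hom N :=
  exist (fun h => h \in submodule_pred (hom_submodule N)) _ (precomp_subproof f).

Lemma precomp_linear : linear precomp.
Proof. by move=> a f h; apply/val_inj. Qed.

HB.instance Definition _ :=
  GRing.isLinear.Build S (Hom M) (Hom N) *:%R precomp precomp_linear.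

End Hom.

Arguments precomp {R S} U {M N} g f.

Definition surjective (A B : Type) (f : A -> B) : Prop :=
  forall y, exists x, f x = y.

Definition projective (R : pzRingType) (P : lmodType R) : Prop :=
  forall (A B : lmodType R) (p : {linear A -> B}) (f : {linear P -> B}),
    surjective p -> exists g : {linear P -> A}, forall x, p (g x) = f x.

Definition exact_at (R : pzRingType) (A B C : lmodType R)
    (f : {linear A -> B}) (g : {linear B -> C}) : Prop :=
  forall y, g y = 0 <-> exists x, f x = y.

Record proj_resolution (R : pzRingType) (M : lmodType R) := ProjResolution {
  res_obj : nat -> lmodType R;
  res_diff : forall n, {linear res_obj n.+1 -> res_obj n};
  res_aug : {linear res_obj 0 -> M};
  res_proj : forall n, projective (res_obj n);
  res_aug_surj : surjective res_aug;
  res_exact0 : exact_at (res_diff 0) res_aug;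
  res_exact : forall n, exact_at (res_diff n.+1) (res_diff n)
}.

Section FreeModule.
Variables (R : pzRingType) (T : choiceType).

Definition finsupp_pred : {pred T -> R^o} :=
  fun x => `[< finite_set [set t | x t != 0] >].

Lemma finsupp_closed : submod_closed finsupp_pred.
Proof.
split=> [|a x y].
  apply/asboolP; rewrite (_ : [set t | _] = set0)%classic //.
  by apply/seteqP; split=> // t /=; rewrite eqxx.
move=> /asboolP fx /asboolP fy; apply/asboolP.
apply: (@sub_finite_set _ _ ([set t | x t != 0] `|` [set t | y t != 0])%classic).
  move=> t /= Hxy; apply/orP; apply: contraNT Hxy.
  rewrite negb_or !negbK => /andP[/eqP x0 /eqP y0]; apply/eqP.
  have -> : (a *: x + y) t = a *: x t + y t by [].
  by rewrite x0 y0 scaler0 addr0.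
by rewrite finite_setU.
Qed.

Definition finsupp_submodule : submodule (T -> R^o) := Submodule finsupp_closed.

Definition free_mod : lmodType R := submod finsupp_submodule.

Definition supp (x : free_mod) : set T := [set t | val x t != 0]%classic.

Lemma supp_seq (x : free_mod) :
  exists2 r : seq T, uniq r & (supp x `<=` [set` r])%classic.
Proof.
have /asboolP/finite_seqP[r sx] := valP x.
exists (undup r); first exact: undup_uniq.
by rewrite /supp sx => t /=; rewrite mem_undup.
Qed.

Lemma delta_subproof (t : T) : finsupp_pred (fun u => (u == t)%:R : R^o).
Proof.
apply/asboolP; apply: (@sub_finite_set _ _ [set t]%classic); last exact: finite_set1.
by move=> u /=; have [//|_ /negP[]] := eqVneq u t; rewrite eqxx.
Qed.

Definition delta (t : T) : free_mod :=
  exist (fun h => h \in submodule_pred finsupp_submodule) _ (delta_subproof t).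

Section Lift.
Variables (A : lmodType R) (c : T -> A).

Definition lift (x : free_mod) : A := \sum_(t \in supp x) (val x t : R) *: c t.

Lemma liftE (x : free_mod) (r : seq T) :
  uniq r -> (supp x `<=` [set` r])%classic ->
  lift x = \sum_(t <- r) (val x t : R) *: c t.
Proof.
move=> ur sxr; apply: fsbig_fwiden => // t [_ /= /negP].
by rewrite negbK => /eqP ->; rewrite scale0r.
Qed.

Lemma lift_linear : linear lift.
Proof.
move=> a x y.
have [r1 _ s1] := supp_seq x; have [r2 _ s2] := supp_seq y.
have [r3 _ s3] := supp_seq (a *: x + y).
have ur := undup_uniq (r1 ++ r2 ++ r3).
have sub z r' : (supp z `<=` [set` r'])%classic -> {subset r' <= r1 ++ r2 ++ r3} ->
    (supp z `<=` [set` undup (r1 ++ r2 ++ r3)])%classic.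
  by move=> sz sr t /sz /= /sr; rewrite mem_undup.
rewrite !(@liftE _ _ ur); last 3 first.
- by apply: sub s2 _ => t t2; rewrite !mem_cat t2 orbT.
- by apply: sub s1 _ => t t1; rewrite !mem_cat t1.
- by apply: sub s3 _ => t t3; rewrite !mem_cat t3 !orbT.
rewrite scaler_sumr -big_split; apply: eq_bigr => t _ /=.
by rewrite scalerA -scalerDl.
Qed.

HB.instance Definition _ :=
  GRing.isLinear.Build R free_mod A *:%R lift lift_linear.

Lemma lift_delta t : lift (delta t) = c t.
Proof.
rewrite (@liftE _ [:: t]) //; first by rewrite big_seq1 /= eqxx scale1r.
by move=> u; rewrite /supp /= inE; case: (eqVneq u t) => // _; rewrite eqxx.
Qed.

End Lift.

Lemma lift_id (x : free_mod) : lift delta x = x.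
Proof.
have [r ur sx] := supp_seq x.
rewrite (@liftE _ _ _ r) //.
apply/val_inj/funext => u; rewrite raddf_sum fct_sumE /=.
have [ru|nru] := boolP (u \in r).
  rewrite (bigD1_seq u) //= big1 => [|t /negPf tu].
    by rewrite addr0 -[LHS]/(val x u * (u == u)%:R) eqxx mulr1.
  by rewrite -[LHS]/(val x t * (u == t)%:R) eq_sym tu mulr0.
rewrite big_seq big1 => [|t tr].
  have [//|xu] := eqVneq (val x u) 0; by rewrite (sx u xu) in nru.
rewrite -[LHS]/(val x t * (u == t)%:R); have [ut|_] := eqVneq u t.
  by rewrite ut tr in nru.
by rewrite mulr0.
Qed.

Lemma lift_uniq (A : lmodType R) (f : {linear free_mod -> A}) x :
  f x = lift (f \o delta) x.
Proof.
have [r ur sx] := supp_seq x.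
rewrite -[in LHS](lift_id x) !(@liftE _ _ _ r) //.
by rewrite linear_sum; apply: eq_bigr => t _; rewrite linearZ.
Qed.

Lemma free_projective : projective free_mod.
Proof.
move=> A B p f psurj.
have [c cP] := choice (fun t => psurj (f (delta t))).
exists (lift c) => x.
rewrite (lift_uniq f) -[LHS]/((p \o lift c) x) (lift_uniq (p \o lift c)).
have [r ur sx] := supp_seq x.
rewrite !(@liftE _ _ _ r) //.
by apply: eq_bigr => t _ /=; rewrite lift_delta cP.
Qed.

End FreeModule.

(* The standard free resolution: M is covered by the free module on all its   *)
(* elements, then so is the kernel of this cover, and so on.                  *)
Section FreeResolution.
Variables (R : pzRingType).

Definition cover (M : lmodType R) : {linear free_mod R M -> M} :=
  lift (fun m : M => m).

Definition syz (M : lmodType R) : lmodType R := submod (kernel (cover M)).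

Definition syz_incl (M : lmodType R) : {linear syz M -> free_mod R M} :=
  (val : syz M -> free_mod R M).

Lemma cover_surj (M : lmodType R) : surjective (cover M).
Proof. by move=> y; exists (delta R y); exact: (lift_delta (fun m : M => m)). Qed.

Lemma cover_exact (M : lmodType R) (x : free_mod R M) :
  cover M x = 0 <-> exists y, syz_incl M (cover (syz M) y) = x.
Proof.
split=> [x0|[y <-]]; last exact/eqP/(valP (cover (syz M) y)).
have kx : x \in submodule_pred (kernel (cover M)) by exact/eqP.
have [y yx] := cover_surj (exist _ x kx : syz M).
by exists y; rewrite yx.
Qed.

Variable M : lmodType R.

Definition free_res_obj (n : nat) : lmodType R := free_mod R (iter n syz M).

Definition free_res_diff (n : nat) :
    {linear free_res_obj n.+1 -> free_res_obj n} :=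
  syz_incl (iter n syz M) \o cover (syz (iter n syz M)).

Lemma free_res_exact n : exact_at (free_res_diff n.+1) (free_res_diff n).
Proof.
move=> x; rewrite -[X in _ <-> X]cover_exact; split=> [x0|x0].
  exact: val_inj.
by rewrite -[LHS]/(syz_incl _ (cover _ x)) x0 raddf0.
Qed.

Definition free_resolution : proj_resolution M :=
  @ProjResolution R M free_res_obj free_res_diff (cover M)
    (fun n => @free_projective R (iter n syz M)) (@cover_surj M)
    (@cover_exact M) free_res_exact.

End FreeResolution.

Section Ext.
Variables (R S : pzRingType) (U : bimodule R S).

(* the cohomology of Hom(P, U) for a projective resolution P of M; degree 0   *)
(* is Hom(M, U) itself rather than its isomorphic copy ker(P_0^* -> P_1^* )   *)
Definition Ext_res (M : lmodType R) (P : proj_resolution M) (i : nat) :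
    lmodType S :=
  if i is j.+1
  then homology (precomp U (res_diff P j)) (precomp U (res_diff P j.+1))
  else Hom U M.

Definition Ext (i : nat) (M : lmodType R) : lmodType S :=
  Ext_res (free_resolution M) i.

End Ext.

Definition zero_mod (R : pzRingType) (V : lmodType R) : Prop :=
  forall x : V, x = 0.

Definition grade_ge (R S : pzRingType) (U : bimodule R S) (M : lmodType R)
    (i : nat) : Prop :=
  forall j, (j < i)%N -> zero_mod (Ext U j M).

Definition fin_gen (R : pzRingType) (V : lmodType R) : Prop :=
  exists n (g : 'I_n -> V), forall x, exists c : 'I_n -> R,
    x = \sum_(i < n) c i *: g i.

Definition noetherian_mod (R : pzRingType) (V : lmodType R) : Prop :=
  forall I : nat -> submodule V, (forall n, {subset I n <= I n.+1}) ->
    exists n, forall m, (n <= m)%N -> I m =i I n.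

Definition left_noetherian (R : pzRingType) : Prop :=
  noetherian_mod (R^o : lmodType R).

Definition right_noetherian (R : pzRingType) : Prop := left_noetherian R^c.

Section Conditions.
Variables (R S : pzRingType) (U : bimodule R S).

Definition homothety_fun (a : R) (u : rside U) : rside U := @lact R S U a u.

Lemma homothety_linear a : linear (homothety_fun a).
Proof.
move=> s u v; rewrite /homothety_fun [LHS]lactDr.
congr (_ + _); exact: (lractC a s u).
Qed.

HB.instance Definition _ (a : R) :=
  GRing.isLinear.Build S (rside U) (rside U) *:%R (homothety_fun a)
    (homothety_linear a).

Definition homothety (a : R) : {linear rside U -> rside U} := homothety_fun a.

End Conditions.

(* Both natural maps are ring morphisms, R -> End_S(U) and S -> End_R(U), by  *)
(* the module axioms, so they are isomorphisms as soon as they are bijective. *)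
(* For S = Gamma^c the second one is Gamma -> End_R(U)^op.                    *)
Definition faithfully_balanced (R S : pzRingType) (U : bimodule R S) : Prop :=
  bijective (homothety U) /\ bijective (homothety (swap U)).

Definition selforthogonal (R S : pzRingType) (U : bimodule R S) : Prop :=
  forall i, (1 <= i)%N ->
    zero_mod (Ext U i (lside U)) /\ zero_mod (Ext (swap U) i (rside U)).

(* Main.v *)
(* Only the passage from one side of U to the other has content: the single-  *)
(* degree vanishing conditions give the grade conditions by passing to        *)
(* syzygies. For an R-S-bimodule U, let N be a finitely generated S-module, Q *)
(* a resolution of N by finite free modules, C m = Hom(Q m, U) with           *)
(* cohomology H m, and Y m the cokernel of C m -> C m.+1. Since U is balanced *)
(* and selforthogonal, the C m are acyclic for Hom(-, U) and dualize back to  *)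
(* the Q m. Inductively, H m.+1 has grade at least m for m <= g and X = H     *)
(* g.+2 has grade at least g. The first fact forces Ext^a(Y m, U) = 0 for 1   *)
(* <= a <= m <= g.+1, so two connecting maps identify E = Ext^g(X, U) with    *)
(* Ext^(g+2)(Y g.+2, U), and the hypothesis on the other side makes E of      *)
(* grade at least g.+1. On the other hand, for a resolution P of X, E embeds  *)
(* in the cokernel of Hom(P g.-1, U) -> Hom(P g, U), which is resolved by the *)
(* g+1 modules Hom(P t, U), t <= g, as grade X >= g. These are powers of U,   *)
(* hence have no Ext from E in degrees up to g, so that embedding and E       *)
(* itself vanish.                                                             *)

From HB Require Import structures.
From mathcomp Require Import all_boot all_algebra.
From mathcomp Require Import boolp classical_sets functions.
Require Import Defs.

Set Implicit Arguments.
Unset Strict Implicit.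
Unset Printing Implicit Defensive.

Import GRing.Theory.
Local Open Scope ring_scope.

(** * Linear maps, isomorphisms and homology *)

(** A grade condition contains the single-degree condition. Conversely, Ext^(i+1)(M,U) is Ext^i of a
    syzygy of M, so induction on i leaves only degree i-1 to check ([grade_of_ext_zero]). The sides
    are exchanged by [grade_transfer], applied to U and to [swap U]. Its induction step must kill E
    = Ext^g(X,U), where X = Ext^(g+2)(N,U) already has grade at least g. Two lemmas do this.

    [ext_ext_isomorphic] rewrites E as Ext^(g+2) of a finitely generated module over the other ring,
    so the hypothesis there gives E grade at least g+1. That module is a cokernel in the U-dual of a
    finite free resolution of N. Balance turns functionals on the dual into evaluations
    ([dual_functional]), selforthogonality makes its terms acyclic, and [coker_ext_zero] clears the
    Ext groups next to the connecting maps.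

    [ext_grade_zero] shows that so large a grade forces E = 0: a chase ([chase0]) in the double
    complex of maps from a resolution of E to the dual of a resolution of X proves that every
    cocycle representing an element of E is a boundary.

    The homological algebra beneath is built on explicit resolutions: comparison of resolutions
    makes Ext independent of the choice, and mapping cones provide the needed pieces of the long
    exact sequence. *)

Section LinearMaps.
Variable R : pzRingType.
Implicit Types A B C P V : lmodType R.

Lemma linear_mk A B (f : A -> B) :
  linear f -> exists F : {linear A -> B}, forall x, F x = f x.
Proof.
move=> lf; pose F := GRing.isLinear.Build R A B *:%R f lf.
by exists (HB.pack_for {linear A -> B} f F).
Qed.

Definition mk_linear A B (f : A -> B) (lf : linear f) : {linear A -> B} :=
  HB.pack_for {linear A -> B} f (GRing.isLinear.Build R A B *:%R f lf).

Lemma linear_injective A B (f : {linear A -> B}) :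
  (forall x, f x = 0 -> x = 0) -> injective f.
Proof.
by move=> f0 x y e; apply/eqP; rewrite -subr_eq0; apply/eqP/f0; rewrite linearB e subrr.
Qed.

Lemma factor_surj A B C (p : {linear A -> B}) (f : {linear A -> C}) :
  surjective p -> (forall x, p x = 0 -> f x = 0) ->
  exists h : {linear B -> C}, forall x, h (p x) = f x.
Proof.
move=> ps pf; have [s sP] := choice ps.
have E x y : p x = p y -> f x = f y.
  by move=> e; apply/eqP; rewrite -subr_eq0 -linearB; apply/eqP/pf; rewrite linearB e subrr.
have lh : linear (f \o s).
  by move=> a x y /=; rewrite -linearP; apply: E; rewrite linearP !sP.
by exists (mk_linear lh) => x; apply: E; rewrite sP.
Qed.

Lemma factor_inj A B C (i : {linear A -> B}) (f : {linear C -> B}) :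
  injective i -> (forall x, exists a, i a = f x) ->
  exists h : {linear C -> A}, forall x, i (h x) = f x.
Proof.
move=> ii /choice[h hP].
have lh : linear h by move=> a x y; apply: ii; rewrite linearP !hP linearP.
by exists (mk_linear lh).
Qed.

Definition image_pred A B (f : {linear A -> B}) : {pred B} :=
  fun y => `[< exists x, f x = y >].

Lemma image_closed A B (f : {linear A -> B}) : submod_closed (image_pred f).
Proof.
split=> [|a x y]; first by apply/asboolP; exists 0; rewrite linear0.
by move=> /asboolP[u <-] /asboolP[v <-]; apply/asboolP; exists (a *: u + v); rewrite linearP.
Qed.

Definition image_sub A B (f : {linear A -> B}) : submodule B :=
  Submodule (image_closed f).

Definition submod_incl V (I : submodule V) : {linear submod I -> V} :=
  (val : submod I -> V).

Definition quot_proj V (I : submodule V) : {linear V -> quotmod I} :=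
  mk_linear (fun a x y => etrans (qpiD I _ _) (congr1 (+%R^~ _) (esym (qscale_pi I a x)))).

Lemma quot_proj_surj V (I : submodule V) : surjective (quot_proj I).
Proof. by move=> q; exists (repr q); exact: qpi_repr. Qed.

Lemma quot_proj_eq0 V (I : submodule V) x :
  quot_proj I x = 0 <-> x \in submodule_pred I.
Proof.
rewrite -(linear0 (quot_proj I)) -[X in _ <-> X \in _]subr0; exact: qpi_eq.
Qed.

(** Projectivity is tested on surjections, so [p] and [f] are corestricted to the image of [p]. *)
Lemma projective_lift P A B (p : {linear A -> B}) (f : {linear P -> B}) :
  projective P -> (forall x, exists a, p a = f x) ->
  exists g : {linear P -> A}, forall x, p (g x) = f x.
Proof.
move=> pP pf; pose i := submod_incl (image_sub p).
have ii : injective i by exact: val_inj.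
have im y : (exists a, p a = y) -> exists b, i b = y.
  by move=> e; exists (exist _ y (asboolT e)).
have [p' p'P] := factor_inj ii (fun a => im (p a) (ex_intro _ a erefl)).
have [f' f'P] := factor_inj ii (fun x => im (f x) (pf x)).
have p's : surjective p'.
  move=> b; have /asboolP[a pa] := valP b; exists a; apply: ii.
  by rewrite p'P pa.
have [g gP] := pP _ _ p' f' p's.
by exists g => x; rewrite -p'P gP f'P.
Qed.

Lemma prod_projective P Q : projective P -> projective Q ->
  projective (P * Q)%type.
Proof.
move=> pP pQ A B p f ps.
have l1 : linear (fun x : P => f (x, 0)).
  by move=> a x y; rewrite -linearP; congr (f (_, _)); rewrite /= scaler0 addr0.
have l2 : linear (fun x : Q => f (0, x)).
  by move=> a x y; rewrite -linearP; congr (f (_, _)); rewrite /= scaler0 addr0.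
have [g1 g1P] := pP _ _ p (mk_linear l1) ps.
have [g2 g2P] := pQ _ _ p (mk_linear l2) ps.
have lg : linear (fun x : P * Q => g1 x.1 + g2 x.2).
  by move=> a x y /=; rewrite !linearP scalerDr addrACA.
exists (mk_linear lg) => -[x y] /=; rewrite linearD g1P g2P /= -linearD.
by congr (f (_, _)); rewrite /= ?addr0 ?add0r.
Qed.

Definition isomorphic A B := exists2 f : {linear A -> B}, injective f & surjective f.

Lemma isomorphic_sym A B : isomorphic A B -> isomorphic B A.
Proof.
move=> [f fi fs]; have [h hP] := @factor_inj _ _ _ f (idfun : {linear B -> B}) fi fs.
exists h => [x y e|x]; first by rewrite -[x]hP e hP.
by exists (f x); apply: fi; rewrite hP.
Qed.

Lemma isomorphic_trans A B C : isomorphic A B -> isomorphic B C -> isomorphic A C.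
Proof.
move=> [f fi fs] [g gi gs]; exists (g \o f); first exact: inj_comp.
by move=> z; have [y <-] := gs z; have [x <-] := fs y; exists x.
Qed.

Lemma isomorphic_zero A B : isomorphic A B -> zero_mod A -> zero_mod B.
Proof. by move=> [f _ fs] A0 y; have [x <-] := fs y; rewrite (A0 x) linear0. Qed.

Lemma isomorphic_same_kernel A B C (p : {linear A -> B}) (q : {linear A -> C}) :
  surjective p -> surjective q -> (forall x, p x = 0 <-> q x = 0) ->
  isomorphic B C.
Proof.
move=> ps qs pq; have [h hP] := factor_surj ps (fun x => (pq x).1).
exists h; last by move=> z; have [x <-] := qs z; exists (p x).
apply: linear_injective => y; have [x <-] := ps y.
by rewrite hP => /pq.
Qed.

Lemma homology_zeroP A B C (f : {linear A -> B}) (g : {linear B -> C}) :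
  zero_mod (homology f g) <-> (forall y, g y = 0 -> exists x, f x = y).
Proof.
split=> [z y gy|ex q].
  have ky : y \in submodule_pred (kernel g) by exact/eqP.
  pose s : submod (kernel g) := exist _ y ky.
  have /quot_proj_eq0 := z (quot_proj (Submodule (boundary_closed f g)) s).
  by move=> /asboolP.
have [x <-] := quot_proj_surj q; apply/quot_proj_eq0/asboolP.
by apply: ex; exact/eqP/(valP x).
Qed.

(** The comparison map is required in the middle degree only. This also covers maps commuting with
    the differentials only up to sign, such as the projection of a mapping cone. *)
Lemma homology_isomorphic A B C A' B' C'
    (f : {linear A -> B}) (g : {linear B -> C})
    (f' : {linear A' -> B'}) (g' : {linear B' -> C'}) (h : {linear B -> B'}) :
  (forall x, g x = 0 -> g' (h x) = 0) ->
  (forall x, g x = 0 -> (exists a, f a = x) <-> (exists a, f' a = h x)) ->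
  (forall y, g' y = 0 -> exists2 x, g x = 0 & exists a, f' a = y - h x) ->
  isomorphic (homology f g) (homology f' g').
Proof.
move=> gg ff sur.
have [k kP] : exists k : {linear submod (kernel g) -> submod (kernel g')},
    forall x, val (k x) = h (val x).
  apply: (@factor_inj _ _ _ (submod_incl (kernel g')) (h \o submod_incl (kernel g))).
    exact: val_inj.
  move=> x; have gx : g' (h (val x)) = 0 by apply: gg; exact/eqP/(valP x).
  by exists (exist _ (h (val x)) (introT eqP gx)).
pose p := quot_proj (Submodule (boundary_closed f g)).
pose q := quot_proj (Submodule (boundary_closed f' g')).
apply: (@isomorphic_same_kernel _ _ _ p (q \o k)).
- exact: quot_proj_surj.
- move=> z; have [y <-] := quot_proj_surj z.
  have /sur[x gx [a fa]] : g' (val y) = 0 by exact/eqP/(valP y).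
  pose s : submod (kernel g) := exist _ x (introT eqP gx); exists s.
  apply/esym/subr0_eq; change (q y - q (k s) = 0); rewrite -linearB.
  by apply/quot_proj_eq0/asboolP; exists a; rewrite fa -[h x]/(h (val s)) -kP.
- move=> x /=; rewrite !quot_proj_eq0.
  have gx : g (val x) = 0 by exact/eqP/(valP x).
  split=> /asboolP e; apply/asboolP; first by rewrite kP; apply/ff.
  by move: e; rewrite kP => /(ff _ gx).
Qed.

Lemma isomorphic_homology (K : lmodType R) A B C (f : {linear A -> B}) (g : {linear B -> C})
    (h : {linear K -> B}) :
  (forall x, g (h x) = 0) ->
  (forall x, (exists a, f a = h x) -> x = 0) ->
  (forall y, g y = 0 -> exists x, exists a, f a = y - h x) ->
  isomorphic K (homology f g).
Proof.
move=> gh inj sur.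
have [k kP] : exists k : {linear K -> submod (kernel g)}, forall x, val (k x) = h x.
  apply: (@factor_inj _ _ _ (submod_incl (kernel g)) h) => [|x]; first exact: val_inj.
  by exists (exist _ (h x) (introT eqP (gh x))).
pose q := quot_proj (Submodule (boundary_closed f g)).
exists (q \o k) => [|z].
  apply: linear_injective => x /= /quot_proj_eq0/asboolP[a fa].
  by apply: inj; exists a; rewrite fa kP.
have [y <-] := quot_proj_surj z.
have /sur[x [a fa]] : g (val y) = 0 by exact/eqP/(valP y).
exists x; apply/esym/subr0_eq; change (q y - q (k x) = 0); rewrite -linearB.
by apply/quot_proj_eq0/asboolP; exists a; rewrite fa -kP.
Qed.

End LinearMaps.

(** * Lifting along projective resolutions *)

Section Resolutions.
Variable R : pzRingType.
Implicit Types (A B L V : lmodType R).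

Lemma res_aug_diff A (P : proj_resolution A) x : res_aug P (res_diff P 0 x) = 0.
Proof. exact: (iffRL (res_exact0 _) (ex_intro _ x erefl)). Qed.

Lemma res_diff_diff A (P : proj_resolution A) n x :
  res_diff P n (res_diff P n.+1 x) = 0.
Proof. exact: (iffRL (res_exact _) (ex_intro _ x erefl)). Qed.

Lemma res_lift0 A (P : proj_resolution A) L (f : {linear L -> res_obj P 0}) :
  projective L -> (forall x, res_aug P (f x) = 0) ->
  exists g : {linear L -> res_obj P 1}, forall x, res_diff P 0 (g x) = f x.
Proof. by move=> pL f0; apply: projective_lift => // x; exact: (iffLR (res_exact0 _) (f0 x)). Qed.

Lemma res_liftS A (P : proj_resolution A) L n
    (f : {linear L -> res_obj P n.+1}) :
  projective L -> (forall x, res_diff P n (f x) = 0) ->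
  exists g : {linear L -> res_obj P n.+2}, forall x, res_diff P n.+1 (g x) = f x.
Proof. by move=> pL f0; apply: projective_lift => // x; exact: (iffLR (res_exact _) (f0 x)). Qed.

Section ChainMaps.
Variables (A B : lmodType R) (P : proj_resolution A) (Q : proj_resolution B).

Definition chain_map (f : forall n, {linear res_obj P n -> res_obj Q n}) : Prop :=
  forall n x, res_diff Q n (f n.+1 x) = f n (res_diff P n x).

Definition lifts (h : A -> B)
    (f : forall n, {linear res_obj P n -> res_obj Q n}) : Prop :=
  forall x, res_aug Q (f 0 x) = h (res_aug P x).

Lemma chain_lift_step n (g : {linear res_obj P n.+1 -> res_obj Q n.+1})
    (f : {linear res_obj P n -> res_obj Q n}) :
  (forall x, res_diff Q n (g x) = f (res_diff P n x)) ->
  exists g' : {linear res_obj P n.+2 -> res_obj Q n.+2},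
    forall x, res_diff Q n.+1 (g' x) = g (res_diff P n.+1 x).
Proof.
move=> gf; apply: (@res_liftS _ Q _ _ (g \o res_diff P n.+1)); first exact: res_proj.
by move=> x /=; rewrite gf res_diff_diff linear0.
Qed.

Lemma chain_lift (h : {linear A -> B}) :
  exists2 f : forall n, {linear res_obj P n -> res_obj Q n},
    chain_map f & lifts h f.
Proof.
have [f0 f0P] := @projective_lift _ _ _ _ (res_aug Q) (h \o res_aug P) (@res_proj _ _ P 0)
  (fun x => @res_aug_surj _ _ Q (h (res_aug P x))).
have [f1 f1P] : exists f1 : {linear res_obj P 1 -> res_obj Q 1},
    forall x, res_diff Q 0 (f1 x) = f0 (res_diff P 0 x).
  apply: (@res_lift0 _ Q _ (f0 \o res_diff P 0)); first exact: res_proj.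
  by move=> x; rewrite /= f0P /= res_aug_diff linear0.
(* The recursion carries two consecutive lifts together with their commuting square, because the
   square is what allows the next lift. *)
pose T n := {p : {linear res_obj P n -> res_obj Q n} *
                 {linear res_obj P n.+1 -> res_obj Q n.+1} |
             forall x, res_diff Q n (p.2 x) = p.1 (res_diff P n x)}.
pose next n (t : T n) : T n.+1 :=
  let: exist g gP := cid (chain_lift_step (svalP t)) in
  exist _ ((sval t).2, g) gP.
pose t := nat_rect T (exist _ (f0, f1) f1P) next.
exists (fun n => (sval (t n)).1) => // n x.
have -> : (sval (t n.+1)).1 = (sval (t n)).2.
  by rewrite /= /next; case: (cid _).
exact: (svalP (t n)).
Qed.

(** This is the homotopy identity f = d s + s' d composed with d. The term s' d then drops out, so
    each degree needs a single map and no coherent family has to be chosen. *)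
Lemma null_homotopy (f : forall n, {linear res_obj P n -> res_obj Q n}) :
  chain_map f -> (forall x, res_aug Q (f 0 x) = 0) ->
  forall n, exists s : {linear res_obj P n -> res_obj Q n.+1},
    forall x, res_diff Q n (s (res_diff P n x)) = f n (res_diff P n x).
Proof.
move=> cf f0; elim=> [|n [s sP]].
  have [s sP] := res_lift0 (@res_proj _ _ P 0) f0.
  by exists s => x; rewrite sP.
have [|s' s'P] := @res_liftS _ Q _ _ (f n.+1 \- (s \o res_diff P n)) (@res_proj _ _ P n.+1).
  by move=> x; rewrite /= linearB /= cf sP subrr.
by exists s' => x; rewrite s'P /= res_diff_diff !linear0 addr0.
Qed.

(** The map f - s d takes values in cycles, so it lifts through the next differential, which the
    cocycle [c] kills; hence c f = (c s) d. *)
Lemma null_homotopy_cocycle (f : forall n, {linear res_obj P n -> res_obj Q n}) :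
  chain_map f -> (forall x, res_aug Q (f 0 x) = 0) ->
  forall V n (c : {linear res_obj Q n.+1 -> V}),
    (forall x, c (res_diff Q n.+1 x) = 0) ->
    exists b : {linear res_obj P n -> V}, forall x, c (f n.+1 x) = b (res_diff P n x).
Proof.
move=> cf f0 V n c c0; have [s sP] := null_homotopy cf f0 n.
have [|s' s'P] := @res_liftS _ Q _ _ (f n.+1 \- (s \o res_diff P n)) (@res_proj _ _ P n.+1).
  by move=> x; rewrite /= linearB /= cf sP subrr.
exists (c \o s) => x; apply/esym/subr0_eq; rewrite -[0]oppr0 -(c0 (s' x)) s'P /= linearB opprB.
by [].
Qed.

End ChainMaps.

(** Vanishing of Ext^n(A,V) for an arbitrary module [V]: unlike in [Ext], the coefficients carry no
    second action. *)
Definition ext_zero A (P : proj_resolution A) V (n : nat) : Prop :=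
  if n is m.+1 then
    forall c : {linear res_obj P m.+1 -> V}, (forall x, c (res_diff P m.+1 x) = 0) ->
    exists b : {linear res_obj P m -> V}, forall x, c x = b (res_diff P m x)
  else forall c : {linear A -> V}, forall x, c x = 0.

(** The hypothesis makes [A] a direct summand of a finite power of [B], without forming that power.
    After lifting to resolutions, id - sum e' p' covers zero, so it sends cocycles to coboundaries,
    while the part through [Q] is handled by [zQ]. *)
Lemma ext_zero_summand A B (P : proj_resolution A) (Q : proj_resolution B) V n
    (T : finType) (e : T -> {linear B -> A}) (p : T -> {linear A -> B}) :
  (forall x, \sum_t e t (p t x) = x) ->
  ext_zero Q V n.+1 -> ext_zero P V n.+1.
Proof.
move=> ep zQ c c0.
have /choice[e' /all_and2[ce le]] t :
    exists f : forall m, {linear res_obj Q m -> res_obj P m}, chain_map f /\ lifts (e t) f.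
  by have [f ? ?] := chain_lift Q P (e t); exists f.
have /choice[p' /all_and2[cp lp]] t :
    exists f : forall m, {linear res_obj P m -> res_obj Q m}, chain_map f /\ lifts (p t) f.
  by have [f ? ?] := chain_lift P Q (p t); exists f.
have /choice[b bP] t : exists b : {linear res_obj Q n -> V},
    forall x, c (e' t n.+1 x) = b (res_diff Q n x).
  apply: (zQ (c \o e' t n.+1)) => x /=.
  by rewrite -ce c0.
have lf m : linear (fun x : res_obj P m => x - \sum_t e' t m (p' t m x)).
  move=> a x y; rewrite scalerBr scaler_sumr addrACA -opprD -big_split.
  by congr (_ - _); apply: eq_bigr => t _; rewrite !linearP.
pose f m := mk_linear (lf m).
have cf : chain_map f.
  move=> m x; rewrite /f /= linearB linear_sum; congr (_ - _).
  by apply: eq_bigr => t _; rewrite ce cp.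
have f0 x : res_aug P (f 0 x) = 0.
  apply/eqP; rewrite /= linearB linear_sum subr_eq0 -[X in X == _]ep; apply/eqP.
  by apply: eq_bigr => t _; rewrite le lp.
have [b0 b0P] := null_homotopy_cocycle cf f0 c0.
have lb : linear (fun x => b0 x + \sum_t b t (p' t n x)).
  move=> a x y; rewrite scalerDr scaler_sumr addrACA -big_split linearP.
  by congr (_ + _); apply: eq_bigr => t _; rewrite !linearP.
exists (mk_linear lb) => x; rewrite /= -b0P /= linearB linear_sum.
rewrite -[LHS](subrK (\sum_t c (e' t n.+1 (p' t n.+1 x)))).
by congr (_ + _); apply: eq_bigr => t _; rewrite -cp bP.
Qed.

End Resolutions.

(** * Independence of Ext of the resolution *)

Section HomElements.
Variables (R S : pzRingType) (U : bimodule R S).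

Definition hom_of (M : lmodType R) (f : {linear M -> lside U}) : Hom U M :=
  exist (fun h => h \in submodule_pred (hom_submodule U M)) (f : M -> rside U)
    (asboolT (fun a x y => linearP f a x y)).

Lemma hom_linear (M : lmodType R) (h : Hom U M) : linear (val h : M -> lside U).
Proof. exact/asboolP/(valP h). Qed.

Definition lin_of (M : lmodType R) (h : Hom U M) : {linear M -> lside U} :=
  mk_linear (hom_linear h).

Lemma lin_ofE (M : lmodType R) (h : Hom U M) x : lin_of h x = val h x.
Proof. by []. Qed.

Lemma hom_ext (M : lmodType R) (h h' : Hom U M) :
  (forall x, lin_of h x = lin_of h' x) -> h = h'.
Proof. by move=> e; apply/val_inj/funext. Qed.

Lemma hom_eq0 (M : lmodType R) (h : Hom U M) :
  h = 0 <-> (forall x, lin_of h x = 0).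
Proof. by split=> [-> //|h0]; apply: hom_ext. Qed.

Lemma precompE (M N : lmodType R) (g : {linear N -> M}) (h : Hom U M) x :
  lin_of (precomp U g h) x = lin_of h (g x).
Proof. by []. Qed.

Lemma hom_zeroP (M : lmodType R) :
  zero_mod (Hom U M) <-> forall (c : {linear M -> lside U}) x, c x = 0.
Proof.
split=> [z c x|z h]; last by apply/hom_eq0 => x; exact: z.
by have /hom_eq0/(_ x) := z (hom_of c).
Qed.

Lemma ext_res_zeroP (M : lmodType R) (P : proj_resolution M) n :
  zero_mod (Ext_res U P n) <-> ext_zero P (lside U) n.
Proof.
case: n => [|n]; first exact: hom_zeroP.
rewrite [X in X <-> _]homology_zeroP; split=> [z c c0|z h h0].
  have [|b bP] := z (hom_of c); first exact/hom_eq0.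
  by exists (lin_of b) => x; rewrite -precompE bP.
have [|b bP] := z (lin_of h).
  by move=> x; rewrite -precompE h0.
by exists (hom_of b); apply: hom_ext => x; rewrite bP.
Qed.

Lemma hom_isomorphic (A B : lmodType R) :
  isomorphic A B -> isomorphic (Hom U A) (Hom U B).
Proof.
move=> /isomorphic_sym[f fi fs]; exists (precomp U f).
  move=> h h' e; apply: hom_ext => x; have [y <-] := fs x.
  by rewrite -!precompE e.
move=> h; have [g gP] : exists g : {linear A -> B}, forall x, f (g x) = x.
  exact: (@factor_inj _ _ _ _ f (idfun : {linear A -> A})).
exists (hom_of (lin_of h \o g)); apply: hom_ext => x.
by rewrite precompE -[LHS]/(lin_of h (g (f x))); congr (lin_of h _); apply: fi.
Qed.

(** Mutually inverse isomorphisms lift to chain maps whose two composites cover the identity, hence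
    act on cocycles as the identity modulo coboundaries. *)
Lemma ext_res_isomorphic (A B : lmodType R) (P : proj_resolution A)
    (Q : proj_resolution B) n :
  isomorphic A B -> isomorphic (Ext_res U P n) (Ext_res U Q n).
Proof.
case: n => [|n]; first exact: hom_isomorphic.
move=> /isomorphic_sym[i ii si].
have [j jP] : exists j : {linear A -> B}, forall x, i (j x) = x.
  exact: (@factor_inj _ _ _ _ i (idfun : {linear A -> A})).
have jK x : j (i x) = x by apply: ii.
have [f cf lf] := chain_lift Q P i; have [g cg lg] := chain_lift P Q j.
have homotopic A' (P' : proj_resolution A') (k : forall n, {linear res_obj P' n -> res_obj P' n}) :
    chain_map k -> lifts idfun k -> forall m (c : {linear res_obj P' m.+1 -> lside U}),
    (forall x, c (res_diff P' m.+1 x) = 0) ->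
    exists b : {linear res_obj P' m -> lside U}, forall x, c (k m.+1 x) = c x + b (res_diff P' m x).
  move=> ck lk m c c0.
  have [||b bP] := @null_homotopy_cocycle _ _ _ P' P' (fun m => k m \- idfun) _ _ _ m c c0.
  - by move=> q x /=; rewrite linearB ck.
  - by move=> x /=; rewrite linearB lk subrr.
  by exists b => x; rewrite -bP /= linearB addrC subrK.
apply: (homology_isomorphic (h := precomp U (f n.+1))) => h h0.
- apply/hom_eq0 => x; rewrite !precompE -cf -precompE.
  by rewrite h0.
- split=> -[a aP].
    exists (precomp U (f n) a); apply: hom_ext => x.
    by rewrite !precompE -cf -aP.
  have [|||b bP] := homotopic A P (fun m => f m \o g m) _ _ n (lin_of h).
  + by move=> m x /=; rewrite cf cg.
  + by move=> x /=; rewrite lf lg.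
  + by move=> x; rewrite -precompE h0.
  exists (hom_of ((lin_of a \o g n) \- b)); apply: hom_ext => x.
  rewrite precompE -[LHS]/(lin_of a (g n (res_diff P n x)) - b (res_diff P n x)).
  by rewrite -cg -precompE aP precompE [lin_of h _]bP addrK.
- exists (precomp U (g n.+1) h).
    by apply/hom_eq0 => x; rewrite !precompE -cg -precompE h0.
  have [|||b bP] := homotopic B Q (fun m => g m \o f m) _ _ n (lin_of h).
  + by move=> m x /=; rewrite cg cf.
  + by move=> x /=; rewrite lg lf.
  + by move=> x; rewrite -precompE h0.
  exists (- hom_of b); apply: hom_ext => x.
  rewrite precompE -[LHS]/(- b (res_diff Q n x)).
  rewrite -[RHS]/(lin_of h x - lin_of h (g n.+1 (f n.+1 x))).
  by rewrite [lin_of h (g _ _)]bP opprD addrA subrr sub0r.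
Qed.

Lemma ext_isomorphic (A B : lmodType R) n :
  isomorphic A B -> isomorphic (Ext U n A) (Ext U n B).
Proof. exact: ext_res_isomorphic. Qed.

Lemma isomorphic_refl (A : lmodType R) : isomorphic A A.
Proof. by exists idfun => // x; exists x. Qed.

Lemma ext_res_ext (A : lmodType R) (P : proj_resolution A) n :
  isomorphic (Ext_res U P n) (Ext U n A).
Proof. exact/ext_res_isomorphic/isomorphic_refl. Qed.

Lemma ext_zeroP (A : lmodType R) (P : proj_resolution A) n :
  zero_mod (Ext U n A) <-> ext_zero P (lside U) n.
Proof.
rewrite -ext_res_zeroP; split; apply: isomorphic_zero.
  exact/isomorphic_sym/ext_res_ext.
exact: ext_res_ext.
Qed.

Lemma grade_ge_isomorphic (A B : lmodType R) n :
  isomorphic A B -> grade_ge U A n -> grade_ge U B n.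
Proof. by move=> AB gA j /gA; exact/isomorphic_zero/ext_isomorphic. Qed.

End HomElements.

(** * Mapping cones and the long exact sequence *)

Section Cone.
Variables (R : pzRingType) (X Y B : lmodType R).
Variables (i : {linear X -> Y}) (p : {linear Y -> B}).
Hypotheses (i_inj : injective i) (p_surj : surjective p) (ip_exact : exact_at i p).
Variables (P : proj_resolution X) (Q : proj_resolution Y).
Variable f : forall n, {linear res_obj P n -> res_obj Q n}.
Hypotheses (f_chain : chain_map f) (f_lifts : lifts i f).

(** The mapping cone of the lift of [i], with [P] shifted up by one degree. As [i] is injective with
    cokernel [B], the cone resolves [B]. *)
Definition cone_obj (n : nat) : lmodType R :=
  if n is m.+1 then (res_obj Q m.+1 * res_obj P m)%type else res_obj Q 0.

Lemma cone_diff0_linear :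
  linear (fun z : res_obj Q 1 * res_obj P 0 => res_diff Q 0 z.1 + f 0 z.2).
Proof. by move=> a x y; rewrite !linearP scalerDr addrACA. Qed.

Lemma cone_diffS_linear n :
  linear (fun z : res_obj Q n.+2 * res_obj P n.+1 =>
    (res_diff Q n.+1 z.1 + f n.+1 z.2, - res_diff P n z.2)).
Proof.
by move=> a x y; congr (_, _); rewrite /= !linearP ?scalerDr ?scalerN ?opprD // addrACA.
Qed.

Definition cone_diff (n : nat) : {linear cone_obj n.+1 -> cone_obj n} :=
  match n with
  | 0 => mk_linear cone_diff0_linear
  | m.+1 => mk_linear (@cone_diffS_linear m)
  end.

Definition cone_aug : {linear cone_obj 0 -> B} := p \o res_aug Q.

Lemma cone_proj n : projective (cone_obj n).
Proof.
by case: n => [|n]; [exact: res_proj | apply: prod_projective; exact: res_proj].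
Qed.

Lemma cone_aug_surj : surjective cone_aug.
Proof.
by move=> b; have [y <-] := p_surj b; have [q <-] := @res_aug_surj _ _ Q y; exists q.
Qed.

Lemma cone_exact0 : exact_at (cone_diff 0) cone_aug.
Proof.
move=> y; split=> [/= y0|[[q x] <-]].
  have [x xy] := iffLR (ip_exact _) y0; have [x' x'x] := @res_aug_surj _ _ P x.
  have [|q qP] := iffLR (@res_exact0 _ _ Q (y - f 0 x')).
    by rewrite linearB f_lifts x'x xy subrr.
  by exists (q, x'); rewrite /= qP subrK.
rewrite /= !linearD /= res_aug_diff f_lifts linear0 add0r.
by apply: (iffRL (ip_exact _)); exists (res_aug P x).
Qed.

Lemma cone_exactS n : exact_at (cone_diff n.+1) (cone_diff n).
Proof.
have dx m (q : res_obj Q m.+1) x : res_diff Q m q + f m (res_diff P m x) = 0 ->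
    exists q', res_diff Q m.+1 q' + f m.+1 (- x) = q.
  rewrite -f_chain -linearD => /(iffLR (@res_exact _ _ Q _ _))[q' q'P].
  by exists q'; rewrite q'P linearN addrK.
case: n => [|n] [q x] /=; split.
(* Degree 1 is where injectivity of [i] enters: it turns i (aug x) = 0 into aug x = 0. *)
- move=> e; have [|x' x'P] := iffLR (@res_exact0 _ _ P x).
    apply: i_inj; rewrite -f_lifts linear0 -(linear0 (res_aug Q)) -e linearD.
    by rewrite res_aug_diff add0r.
  rewrite -x'P in e *; have [q' q'P] := dx _ _ _ e.
  by exists (q', - x'); rewrite /= q'P linearN opprK.
- move=> [[q' x'] [<- <-]] /=; rewrite !linearD linearN /= res_diff_diff add0r.
  by rewrite f_chain subrr.
- move=> [e /eqP]; rewrite oppr_eq0 => /eqP e'.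
  have [x' x'P] := iffLR (@res_exact _ _ P _ _) e'.
  rewrite -x'P in e *; have [q' q'P] := dx _ _ _ e.
  by exists (q', - x'); rewrite /= q'P linearN opprK.
- move=> [[q' x'] [<- <-]] /=; rewrite !linearD !linearN /= !res_diff_diff add0r.
  by rewrite f_chain subrr !oppr0.
Qed.

Definition cone : proj_resolution B :=
  ProjResolution cone_proj cone_aug_surj cone_exact0 cone_exactS.

Lemma cone_functional (V : lmodType R) n
    (a : {linear res_obj Q n.+1 -> V}) (c : {linear res_obj P n -> V}) :
  exists h : {linear cone_obj n.+1 -> V}, forall z, h z = a z.1 + c z.2.
Proof. by apply: linear_mk => k x y; rewrite !linearP scalerDr addrACA. Qed.

Lemma cone_functional_split (V : lmodType R) n (h : {linear cone_obj n.+1 -> V}) :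
  exists (a : {linear res_obj Q n.+1 -> V}) (c : {linear res_obj P n -> V}),
    forall q x, h (q, x) = a q + c x.
Proof.
have la : linear (fun q : res_obj Q n.+1 => h (q, 0)).
  by move=> k x y; rewrite -linearP; congr (h (_, _)); rewrite /= scaler0 addr0.
have lc : linear (fun x : res_obj P n => h (0, x)).
  by move=> k x y; rewrite -linearP; congr (h (_, _)); rewrite /= scaler0 addr0.
exists (mk_linear la), (mk_linear lc) => q x; rewrite /= -linearD.
by congr (h (_, _)); rewrite /= ?addr0 ?add0r.
Qed.

Lemma cone_cocycle (V : lmodType R) n
    (a : {linear res_obj Q n.+1 -> V}) (c : {linear res_obj P n -> V})
    (h : {linear cone_obj n.+1 -> V}) :
  (forall q x, h (q, x) = a q + c x) ->
  (forall z, h (cone_diff n.+1 z) = 0) ->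
  (forall q, a (res_diff Q n.+1 q) = 0) /\
  (forall x, c (res_diff P n x) = a (f n.+1 x)).
Proof.
move=> hE h0; split=> [q|x].
  by have := h0 (q, 0); rewrite /= hE !linear0 !addr0.
have := h0 (0, x); rewrite /= hE linear0 add0r linearN => /eqP.
by rewrite subr_eq0 => /eqP.
Qed.

Lemma cone_ext1_zero (V : lmodType R) :
  (forall k : {linear X -> V}, exists K : {linear Y -> V}, forall x, K (i x) = k x) ->
  ext_zero Q V 1 -> ext_zero cone V 1.
Proof.
move=> ext zY h h0; have [a [c hE]] := cone_functional_split h.
have [a0 ca] := cone_cocycle hE h0; have [a' a'P] := zY a a0.
(* Once its [Q] component is a coboundary, the cocycle is determined by a functional on [P] in
   degree 0 that kills boundaries, that is, by a map out of [X]. *)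
have [k kP] : exists k : {linear X -> V}, forall x, k (res_aug P x) = (c \- (a' \o f 0)) x.
  apply: factor_surj => [|x /(iffLR (@res_exact0 _ _ P _))[x' <-]] /=; first exact: res_aug_surj.
  by rewrite ca a'P f_chain subrr.
have [K KP] := ext k; exists (a' \+ (K \o res_aug Q)) => -[q x].
rewrite hE /= !linearD /= res_aug_diff f_lifts KP kP linear0 add0r a'P -addrA.
by congr (_ + _); rewrite addrC subrK.
Qed.

Lemma cone_extS_zero (V : lmodType R) n :
  ext_zero P V n.+1 -> ext_zero Q V n.+2 -> ext_zero cone V n.+2.
Proof.
move=> zX zY h h0; have [a [c hE]] := cone_functional_split h.
have [a0 ca] := cone_cocycle hE h0; have [a' a'P] := zY a a0.
have [|b bP] := zX (c \- (a' \o f n.+1)).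
  by move=> x /=; rewrite ca a'P f_chain subrr.
have [h' h'P] := cone_functional a' (\- b); exists h' => -[q x].
rewrite hE h'P /= linearN opprK linearD a'P -addrA; congr (_ + _).
by rewrite -bP /= addrC subrK.
Qed.

Variables (S : pzRingType) (U : bimodule R S).

Lemma cone_connecting0 :
  (forall (k : {linear Y -> lside U}) x, k (i x) = 0) -> ext_zero Q (lside U) 1 ->
  isomorphic (Hom U X) (Ext_res U cone 1).
Proof.
move=> k0 zY; have lsnd : linear (fun z : cone_obj 1 => res_aug P z.2).
  by move=> k x y; rewrite linearP.
apply: (@isomorphic_homology _ _ _ _ _ _ _ (precomp U (mk_linear lsnd))) => [h|h [h' h'P]|h h0].
- apply/hom_eq0 => z; rewrite !precompE -[LHS]/(lin_of h (res_aug P (- res_diff P 0 z.2))).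
  by rewrite linearN res_aug_diff !linear0.
- have e q x : lin_of h (res_aug P x) = lin_of h' (res_diff Q 0 q + f 0 x).
    by rewrite -[LHS](precompE (mk_linear lsnd) h (q, x)) -h'P.
  have [K KP] : exists K : {linear Y -> lside U}, forall q, K (res_aug Q q) = lin_of h' q.
    apply: factor_surj => [|q /(iffLR (@res_exact0 _ _ Q _))[q' <-]]; first exact: res_aug_surj.
    by have := e q' 0; rewrite !linear0 addr0.
  apply/hom_eq0 => x; have [x' <-] := @res_aug_surj _ _ P x.
  by rewrite (e 0) linear0 add0r -KP f_lifts k0.
- have h00 z : lin_of h (cone_diff 1 z) = 0 by rewrite -precompE h0.
  have [a [c hE]] := cone_functional_split (lin_of h).
  have [a0 ca] := cone_cocycle hE h00; have [a' a'P] := zY a a0.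
  have [k kP] : exists k : {linear X -> lside U}, forall x, k (res_aug P x) = (c \- (a' \o f 0)) x.
    apply: factor_surj => [|x /(iffLR (@res_exact0 _ _ P _))[x' <-]] /=; first exact: res_aug_surj.
    by rewrite ca a'P f_chain subrr.
  exists (hom_of k), (hom_of a'); apply: hom_ext => -[q x].
  rewrite precompE -[LHS]/(a' (res_diff Q 0 q + f 0 x)).
  rewrite -[RHS]/(lin_of h (q, x) - k (res_aug P x)) kP hE /= linearD -a'P -addrA.
  by congr (_ + _); rewrite opprB addrC subrK.
Qed.

Lemma cone_connectingS n :
  ext_zero Q (lside U) n.+1 -> ext_zero Q (lside U) n.+2 ->
  isomorphic (Ext_res U P n.+1) (Ext_res U cone n.+2).
Proof.
move=> zY zY'; have lsnd : linear (fun z : cone_obj n.+2 => z.2) by [].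
apply: (@homology_isomorphic _ _ _ _ _ _ _ _ _ _ _ (precomp U (mk_linear lsnd))) => h h0.
- apply/hom_eq0 => z; rewrite !precompE -[LHS]/(lin_of h (- res_diff P n.+1 z.2)).
  by rewrite linearN -precompE h0 oppr0.
- split=> -[b bP].
    have [h' h'P] := @cone_functional _ n \0 (\- lin_of b); exists (hom_of h').
    apply: hom_ext => z; rewrite !precompE -[RHS]/(lin_of h z.2) -bP precompE.
    by rewrite [LHS]h'P /= add0r -!lin_ofE linearN opprK.
  have [a [c bE]] := cone_functional_split (lin_of b).
  have e q x : lin_of h x = a (res_diff Q n.+1 q + f n.+1 x) - c (res_diff P n x).
    rewrite -[LHS]/(lin_of (precomp U (mk_linear lsnd) h) (q, x)) -bP precompE.
    by rewrite [LHS](bE (_ + _) (- _)) linearN.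
  have [q|a' a'P] := zY a.
    by have := e q 0; rewrite !linear0 !addr0.
  exists (hom_of ((a' \o f n) \- c)); apply: hom_ext => x.
  by rewrite precompE (e 0) linear0 add0r a'P f_chain.
- have h00 z : lin_of h (cone_diff n.+2 z) = 0 by rewrite -precompE h0.
  have [a [c hE]] := cone_functional_split (lin_of h).
  have [a0 ca] := cone_cocycle hE h00; have [a' a'P] := zY' a a0.
  exists (hom_of (c \- (a' \o f n.+1))).
    by apply/hom_eq0 => x; rewrite precompE /= ca a'P f_chain subrr.
  have [h' h'P] := @cone_functional _ n a' \0; exists (hom_of h').
  apply: hom_ext => -[q x]; rewrite precompE [LHS]h'P /= addr0.
  rewrite -[RHS]/(lin_of h (q, x) - (c x - a' (f n.+1 x))) hE linearD -a'P -addrA.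
  by congr (_ + _); rewrite opprB addrC subrK.
Qed.

End Cone.

Section LongExactSequence.
Variables (R S : pzRingType) (U : bimodule R S) (X Y B : lmodType R).
Variables (i : {linear X -> Y}) (p : {linear Y -> B}).
Hypotheses (i_inj : injective i) (p_surj : surjective p) (ip_exact : exact_at i p).

Let les_lift := chain_lift (free_resolution X) (free_resolution Y) i.

Lemma ext1_zero_quotient :
  (forall k : {linear X -> lside U}, exists K : {linear Y -> lside U}, forall x, K (i x) = k x) ->
  zero_mod (Ext U 1 Y) -> zero_mod (Ext U 1 B).
Proof.
have [f cf lf] := les_lift => ext zY.
apply/(ext_zeroP U (cone i_inj p_surj ip_exact cf lf) 1).
apply: cone_ext1_zero => //; exact/ext_res_zeroP.
Qed.

Lemma extS_zero_quotient n :
  zero_mod (Ext U n X) -> zero_mod (Ext U n.+1 Y) -> zero_mod (Ext U n.+1 B).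
Proof.
case: n => [|n] zX zY.
  apply: ext1_zero_quotient => // k; exists \0 => x.
  by rewrite (iffLR (hom_zeroP U X) zX k x).
have [f cf lf] := les_lift.
apply/(ext_zeroP U (cone i_inj p_surj ip_exact cf lf) n.+2).
by apply: cone_extS_zero; exact/ext_res_zeroP.
Qed.

Lemma connecting_isomorphic0 :
  (forall (k : {linear Y -> lside U}) x, k (i x) = 0) -> zero_mod (Ext U 1 Y) ->
  isomorphic (Ext U 0 X) (Ext U 1 B).
Proof.
have [f cf lf] := les_lift => k0 zY.
apply: isomorphic_trans (ext_res_ext U (cone i_inj p_surj ip_exact cf lf) 1).
by apply: cone_connecting0 => //; exact/ext_res_zeroP.
Qed.

Lemma connecting_isomorphicS n :
  zero_mod (Ext U n.+1 Y) -> zero_mod (Ext U n.+2 Y) ->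
  isomorphic (Ext U n.+1 X) (Ext U n.+2 B).
Proof.
have [f cf lf] := les_lift => zY zY'.
apply: isomorphic_trans (ext_res_ext U (cone i_inj p_surj ip_exact cf lf) n.+2).
by apply: cone_connectingS; exact/ext_res_zeroP.
Qed.

End LongExactSequence.

(** * Noetherian rings and finite free resolutions *)

Section FinGen.
Variable R : pzRingType.
Implicit Types A B C V : lmodType R.

Lemma fin_gen_surj A B (f : {linear A -> B}) :
  surjective f -> fin_gen A -> fin_gen B.
Proof.
move=> fs [n [g gP]]; exists n, (fun i => f (g i)) => y.
have [x <-] := fs y; have [c ->] := gP x; exists c.
by rewrite linear_sum; apply: eq_bigr => i _; rewrite linearZ.
Qed.

Lemma fin_gen_extension A B C (i : {linear A -> B}) (p : {linear B -> C}) :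
  (forall y, p y = 0 -> exists x, i x = y) -> surjective p ->
  fin_gen A -> fin_gen C -> fin_gen B.
Proof.
move=> ip ps [m [g gP]] [n [h hP]]; have [s sP] := choice ps.
exists (m + n)%N, (fun k : 'I_(m + n) =>
  match fintype.split k with inl a => i (g a) | inr b => s (h b) end) => y.
have [d dP] := hP (p y).
have [|x xP] := ip (y - \sum_(b < n) d b *: s (h b)).
  apply/eqP; rewrite linearB dP linear_sum subr_eq0.
  by apply/eqP/eq_bigr => b _; rewrite linearZ /= sP.
have [c cP] := gP x.
exists (fun k : 'I_(m + n) => match fintype.split k with inl a => c a | inr b => d b end).
rewrite big_split_ord /= -[LHS](subrK (\sum_(b < n) d b *: s (h b))) -xP cP linear_sum.
congr (_ + _); apply: eq_bigr => k _.
  by rewrite (unsplitK (inl k)) linearZ.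
by rewrite (unsplitK (inr k)).
Qed.

Lemma fin_gen_regular : fin_gen (R^o : lmodType R).
Proof. by exists 1%N, (fun=> 1) => x; exists (fun=> x); rewrite big_ord1 [RHS]mulr1. Qed.

Lemma fin_gen_prod A B : fin_gen A -> fin_gen B -> fin_gen (A * B)%type.
Proof.
have li : linear (fun a : A => (a, 0) : A * B).
  by move=> k x y; congr (_, _); rewrite /= scaler0 addr0.
have lp : linear (fun z : A * B => z.2) by [].
apply: (@fin_gen_extension _ _ _ (mk_linear li) (mk_linear lp)).
  by move=> [a b] /= ->; exists a.
by move=> b; exists (0, b).
Qed.

Definition noetherian A := forall I : submodule A, fin_gen (submod I).

(** If [I] were not finitely generated, adjoining one missing element at a time would give a
    strictly increasing chain. Finitely generated submodules of [I] are encoded as images of maps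
    from finitely generated modules. *)
Lemma noetherian_mod_fin_gen A : noetherian_mod A -> noetherian A.
Proof.
move=> nA I; apply: contrapT => nI.
pose T := {F : lmodType R & {f : {linear F -> A} |
  fin_gen F /\ forall x, f x \in submodule_pred I}}.
pose J (t : T) := image_sub (sval (projT2 t)).
have /choice[next nextP] t : exists t' : T,
    {subset J t <= J t'} /\ ~ {subset J t' <= J t}.
  have [[F [f [fgF fI]]] ->] : exists t', t = t' by exists t.
  have [x xI xf] : exists2 x, x \in submodule_pred I & ~ exists y, f y = x.
    apply: contrapT => H; apply: nI.
    have [h hP] := @factor_inj _ _ _ _ (submod_incl I) f val_inj
      (fun y => ex_intro (fun s : submod I => val s = f y) (exist _ (f y) (fI y)) erefl).
    apply: fin_gen_surj (h) _ fgF => s.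
    have [y yP] : exists y, f y = val s.
      by apply: contrapT => Hy; apply: H; exists (val s) => //; exact: (valP s).
    by exists y; apply: val_inj; rewrite -yP; exact: hP.
  have lf : linear (fun z : F * R^o => f z.1 + (z.2 : R) *: x).
    by move=> k u v; rewrite linearP scalerDl scalerDr -scalerA addrACA.
  have f'I z : mk_linear lf z \in submodule_pred I.
    by rewrite /= rpredD ?rpredZ.
  exists (existT _ _ (exist _ (mk_linear lf) (conj (fin_gen_prod fgF fin_gen_regular) f'I))).
  split=> [_ /asboolP[y <-]|sub].
    by apply/asboolP; exists (y, 0); rewrite /= scale0r addr0.
  apply: xf; apply/asboolP/sub/asboolP; exists (0, 1).
  by rewrite /= scale1r linear0 add0r.
have f0I (x : R^o) : (\0 : {linear R^o -> A}) x \in submodule_pred I by exact: rpred0.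
pose t0 : T := existT _ _ (exist _ _ (conj fin_gen_regular f0I)).
have [n nP] := nA (fun n => J (iter n next t0)) (fun n => (nextP _).1).
by apply: (nextP (iter n next t0)).2 => x; rewrite -(nP n.+1).
Qed.

Lemma preim_closed A B (f : {linear A -> B}) (I : submodule B) :
  submod_closed ((fun x => f x \in submodule_pred I) : {pred A}).
Proof.
split=> [|a x y]; first by rewrite unfold_in linear0 rpred0.
move=> fx fy; change (f (a *: x + y) \in submodule_pred I); rewrite linearP.
by apply: rpredD; first apply: rpredZ.
Qed.

Definition preim_sub A B (f : {linear A -> B}) (I : submodule B) : submodule A :=
  Submodule (preim_closed f I).

Lemma preim_map A B (f : {linear A -> B}) (I : submodule B) :
  exists h : {linear submod (preim_sub f I) -> submod I}, forall x, val (h x) = f (val x).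
Proof.
apply: (@factor_inj _ _ _ _ (submod_incl I) (f \o submod_incl (preim_sub f I))) => [|x].
  exact: val_inj.
by exists (exist _ (f (val x)) (valP x)).
Qed.

Lemma noetherian_surj A B (f : {linear A -> B}) :
  surjective f -> noetherian A -> noetherian B.
Proof.
move=> fs nA I; have [h hP] := preim_map f I.
apply: fin_gen_surj (h) _ (nA _) => y; have [x xP] := fs (val y).
have xI : x \in submodule_pred (preim_sub f I) by rewrite unfold_in /= xP; exact: (valP y).
by exists (exist _ x xI); apply: val_inj; rewrite hP.
Qed.

Lemma noetherian_prod A B : noetherian A -> noetherian B -> noetherian (A * B)%type.
Proof.
move=> nA nB I.
have li : linear (fun a : A => (a, 0) : A * B).
  by move=> k x y; congr (_, _); rewrite /= scaler0 addr0.
have lp : linear (fun z : A * B => z.2) by [].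
have [h hP] := preim_map (mk_linear li) I.
pose q : {linear submod I -> B} := mk_linear lp \o submod_incl I.
have [p pP] := @factor_inj _ _ _ _ (submod_incl (image_sub q)) q val_inj
  (fun x => ex_intro (fun s : submod (image_sub q) => val s = q x)
     (exist _ (q x) (asboolT (ex_intro _ x erefl))) erefl).
apply: (fin_gen_extension (i := h) (p := p)) (nA _) (nB _).
  move=> y py; have y0 : (val y).2 = 0 by rewrite -[LHS]/(q y) -pP py linear0.
  have yI : (val y).1 \in submodule_pred (preim_sub (mk_linear li) I).
    by rewrite unfold_in /= -y0 -surjective_pairing; exact: (valP y).
  by exists (exist _ (val y).1 yI); apply: val_inj; rewrite hP /= -y0 -surjective_pairing.
move=> z; have /asboolP[y yP] := valP z; exists y; apply: val_inj.
by rewrite -yP; exact: pP.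
Qed.

(* R^(n+1) rather than R^n, so that no zero module is needed. *)
Fixpoint regular_power n : lmodType R :=
  if n is m.+1 then (R^o * regular_power m)%type else R^o.

Lemma regular_power_cover A n (g : 'I_n -> A) :
  exists f : {linear regular_power n -> A},
    forall c : 'I_n -> R, exists w, f w = \sum_i c i *: g i.
Proof.
elim: n g => [|n IH] g; first by exists \0 => c; exists 0; rewrite big_ord0.
have [f fP] := IH (fun i => g (fintype.lift ord0 i)).
have lf : linear (fun z : R^o * regular_power n => (z.1 : R) *: g ord0 + f z.2).
  by move=> k u v; rewrite !linearP scalerDl scalerDr addrACA scalerA.
exists (mk_linear lf) => c; have [w wP] := fP (fun i => c (fintype.lift ord0 i)).
by exists (c ord0, w); rewrite big_ord_recl /= wP.
Qed.

Lemma fin_gen_noetherian A : left_noetherian R -> fin_gen A -> noetherian A.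
Proof.
move=> /noetherian_mod_fin_gen nR [n [g gP]].
have [f fP] := regular_power_cover g.
apply: (noetherian_surj (f := f)).
  by move=> y; have [c ->] := gP y; exact: fP.
by elim: n {g gP f fP} => //= n IH; exact: noetherian_prod.
Qed.

Lemma free_mod_decomp n (x : free_mod R 'I_n) :
  x = \sum_i (val x i : R) *: delta R i.
Proof.
rewrite -[LHS]lift_id (@liftE _ _ _ _ x (index_enum 'I_n)) ?index_enum_uniq //.
by move=> i _ /=; rewrite mem_index_enum.
Qed.

Lemma fin_gen_free n : fin_gen (free_mod R 'I_n).
Proof. by exists n, (fun i => delta R i) => x; exists (val x); exact: free_mod_decomp. Qed.

Lemma fin_gen_cover A : fin_gen A ->
  exists n, exists f : {linear free_mod R 'I_n -> A}, surjective f.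
Proof.
move=> [n [g gP]]; exists n, (lift g) => y; have [c ->] := gP y.
exists (\sum_i c i *: delta R i); rewrite linear_sum; apply: eq_bigr => i _.
by rewrite linearZ /= lift_delta.
Qed.

End FinGen.

Section FiniteFreeResolution.
Variables (R : pzRingType) (noetherR : left_noetherian R).

Definition fg_module := {M : lmodType R | fin_gen M}.

Definition fg_rank (M : fg_module) : nat := projT1 (cid (fin_gen_cover (svalP M))).

Definition fg_cover (M : fg_module) : {linear free_mod R 'I_(fg_rank M) -> sval M} :=
  projT1 (cid (projT2 (cid (fin_gen_cover (svalP M))))).

Lemma fg_cover_surj (M : fg_module) : surjective (fg_cover M).
Proof. exact: (projT2 (cid (projT2 (cid (fin_gen_cover (svalP M)))))). Qed.

Definition fg_syz (M : fg_module) : fg_module :=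
  exist _ (submod (kernel (fg_cover M)) : lmodType R)
    (fin_gen_noetherian noetherR (fin_gen_free R (fg_rank M)) (kernel (fg_cover M))).

Lemma fg_cover_exact (M : fg_module) (x : free_mod R 'I_(fg_rank M)) :
  fg_cover M x = 0 <->
  exists y, submod_incl (kernel (fg_cover M)) (fg_cover (fg_syz M) y) = x.
Proof.
split=> [x0|[y <-]]; last exact/eqP/(valP (fg_cover (fg_syz M) y)).
have kx : x \in submodule_pred (kernel (fg_cover M)) by exact/eqP.
have [y yx] := @fg_cover_surj (fg_syz M) (exist _ x kx).
by exists y; rewrite yx.
Qed.

Variable M : fg_module.

Definition fg_res_obj (n : nat) : lmodType R := free_mod R 'I_(fg_rank (iter n fg_syz M)).

Definition fg_res_diff (n : nat) : {linear fg_res_obj n.+1 -> fg_res_obj n} :=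
  submod_incl (kernel (fg_cover (iter n fg_syz M))) \o fg_cover (fg_syz (iter n fg_syz M)).

Lemma fg_res_exact n : exact_at (fg_res_diff n.+1) (fg_res_diff n).
Proof.
move=> x; rewrite -[X in _ <-> X]fg_cover_exact; split=> [x0|x0].
  exact: val_inj.
by rewrite -[LHS]/(submod_incl _ (fg_cover _ x)) x0 linear0.
Qed.

Definition fg_resolution : proj_resolution (sval M) :=
  @ProjResolution R (sval M) fg_res_obj fg_res_diff (fg_cover M)
    (fun n => @free_projective R _) (@fg_cover_surj M)
    (@fg_cover_exact M) fg_res_exact.

End FiniteFreeResolution.

(** An equality rather than an isomorphism, so that terms of a resolution can be replaced by
    rewriting. *)
Definition finite_free (R : pzRingType) (F : lmodType R) : Prop :=
  exists n, F = free_mod R 'I_n.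

Lemma finite_free_resolution (R : pzRingType) (M : lmodType R) :
  left_noetherian R -> fin_gen M ->
  exists P : proj_resolution M, forall n, finite_free (res_obj P n).
Proof.
move=> nR fgM; exists (fg_resolution nR (exist _ M fgM)) => n.
by exists (fg_rank (iter n (fg_syz nR) (exist _ M fgM))).
Qed.

(** * Syzygies and dimension shift *)

Section ShiftResolution.
Variables (R : pzRingType) (M : lmodType R) (P : proj_resolution M).

Definition res_syz : lmodType R := submod (kernel (res_aug P)).

Lemma shift_aug_exists :
  exists h : {linear res_obj P 1 -> res_syz}, forall x, val (h x) = res_diff P 0 x.
Proof.
apply: (@factor_inj _ _ _ _ (submod_incl (kernel (res_aug P)))) => [|x].
  exact: val_inj.
by exists (exist _ (res_diff P 0 x) (introT eqP (res_aug_diff x))).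
Qed.

Lemma shift_resolution : exists Q : proj_resolution res_syz,
  forall (S : pzRingType) (U : bimodule R S) n, Ext_res U Q n.+1 = Ext_res U P n.+2.
Proof.
have [h hP] := shift_aug_exists.
have hs : surjective h.
  move=> y; have /eqP/(iffLR (@res_exact0 _ _ P _))[x xP] := valP y.
  by exists x; apply: val_inj; rewrite hP.
have h0 : exact_at (res_diff P 1) h.
  move=> x; rewrite -[X in _ <-> X](@res_exact _ _ P 0); split=> [e|e].
    by rewrite -hP e.
  by apply: val_inj; rewrite hP.
by exists (@ProjResolution R res_syz (fun n => res_obj P n.+1) (fun n => res_diff P n.+1) h
  (fun n => @res_proj _ _ P n.+1) hs h0 (fun n => @res_exact _ _ P n.+1)).
Qed.

Lemma ext_syz (S : pzRingType) (U : bimodule R S) n :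
  isomorphic (Ext U n.+1 res_syz) (Ext U n.+2 M).
Proof.
have [Q QP] := shift_resolution.
apply: isomorphic_trans (isomorphic_sym (ext_res_ext U Q n.+1)) _.
by rewrite QP; exact: ext_res_ext.
Qed.

Lemma fin_gen_res_syz : finite_free (res_obj P 1) -> fin_gen res_syz.
Proof.
have [h hP] := shift_aug_exists => -[n e].
apply: (fin_gen_surj (f := h)); last by rewrite e; exact: fin_gen_free.
move=> y; have /eqP/(iffLR (@res_exact0 _ _ P _))[x xP] := valP y.
by exists x; apply: val_inj; rewrite hP.
Qed.

End ShiftResolution.

(** * Duals of finite free modules *)

(** Balance is bijectivity onto the type of bundled linear maps, so equality of the bundles is
    needed. *)
Lemma linear_ext (R : pzRingType) (A B : lmodType R) (f g : {linear A -> B}) :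
  (forall x, f x = g x) -> f = g.
Proof.
case: f g => [f [[fa] [fs]]] [g [[ga] [gs]]] /= /funext e; move: fa fs ga gs.
by rewrite e => fa fs ga gs; rewrite (Prop_irrelevance fa ga) (Prop_irrelevance fs gs).
Qed.

Lemma fin_gen_finType (R : pzRingType) (A : lmodType R) (T : finType) (g : T -> A) :
  (forall x, exists c : T -> R, x = \sum_t c t *: g t) -> fin_gen A.
Proof.
move=> gP; exists #|T|, (g \o enum_val) => x; have [c ->] := gP x.
by exists (c \o enum_val); rewrite /= -(big_enum_val (fun t => c t *: g t)).
Qed.

Lemma free_mod_valP (R : pzRingType) (T : choiceType) (a : R) (x y : free_mod R T) t :
  val (a *: x + y) t = (a * val x t : R) + val y t.
Proof.
pose incl := submod_incl (finsupp_submodule R T).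
by rewrite -[val (a *: x + y)]/(incl (a *: x + y)) linearP.
Qed.

Lemma hom_eval_linear (R S : pzRingType) (U : bimodule R S) (M : lmodType R) (x : M) :
  linear (fun h : Hom U M => val h x : rside U).
Proof.
move=> s f g; pose incl := submod_incl (hom_submodule U M).
by rewrite -[val (s *: f + g)]/(incl (s *: f + g)) linearP.
Qed.

Section FiniteFreeDual.
Variables (R S : pzRingType) (U : bimodule R S) (n : nat).
Notation F := (free_mod S 'I_n).

Definition coord_fun (t : 'I_n) (u : lside U) (x : F) : rside U := homothety (swap U) (val x t) u.

Lemma coord_linear t u : linear (coord_fun t u).
Proof.
move=> s x y; rewrite /coord_fun free_mod_valP /homothety /= /homothety_fun.
have -> := ractDl u (s * val x t) (val y t); congr (_ + _).
by have -> := esym (ractA s (val x t) u).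
Qed.

Definition coord_hom (t : 'I_n) (u : lside U) : Hom (swap U) F :=
  hom_of (U := swap U) (mk_linear (coord_linear t u)).

Lemma coord_hom_linear t : linear (coord_hom t).
Proof.
move=> a u v; apply: (@hom_ext _ _ (swap U)) => x.
exact: (linearP (homothety (swap U) (val x t)) a u v).
Qed.

Lemma eval_linear (x : F) : linear (fun h : Hom (swap U) F => val h x : lside U).
Proof. exact: (@hom_eval_linear _ _ (swap U)). Qed.

Definition eval_at (x : F) : {linear Hom (swap U) F -> lside U} := mk_linear (eval_linear x).

Lemma sum_coord_eval (h : Hom (swap U) F) :
  \sum_t mk_linear (@coord_hom_linear t) (eval_at (delta S t) h) = h.
Proof.
apply: (@hom_ext _ _ (swap U)) => x; rewrite [in RHS](free_mod_decomp x) linear_sum.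
rewrite -[LHS]/(eval_at x _) linear_sum; apply: eq_bigr => t _.
by rewrite linearZ.
Qed.

Hypothesis balanced : bijective (homothety (swap U)).

(** The dual of F is U^n. Each coordinate of [phi] is an R-endomorphism of U, hence by balance the
    action of some element of S; these elements are the coordinates of [q]. *)
Lemma free_bidual_surj (phi : {linear Hom (swap U) F -> lside U}) :
  exists q, forall h, phi h = val h q.
Proof.
have [g _ gK] := balanced.
pose s t := g (phi \o mk_linear (@coord_hom_linear t)).
exists (\sum_t s t *: delta S t) => h.
rewrite -[in LHS](sum_coord_eval h) linear_sum -[RHS]/(lin_of (U := swap U) h _) linear_sum.
apply: eq_bigr => t _; rewrite [RHS]linearZ.
have e := gK (phi \o mk_linear (@coord_hom_linear t)).
have /= := esym (congr1 (fun l : {linear lside U -> lside U} => l (eval_at (delta S t) h)) e).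
by move=> ->.
Qed.

Lemma free_bidual_inj (q : F) : (forall h : Hom (swap U) F, val h q = 0) -> q = 0.
Proof.
move=> q0; apply/val_inj/funext => t; apply: (bij_inj balanced).
apply: linear_ext => u; rewrite -[LHS]/(val (coord_hom t u) q) q0.
by rewrite -[RHS]/((0 : S) *: (u : rside U)) scale0r.
Qed.

Lemma fin_gen_dual : fin_gen (lside U) -> fin_gen (Hom (swap U) F).
Proof.
move=> [m [g gP]].
apply: (@fin_gen_finType _ _ ('I_n * 'I_m)%type (fun z => coord_hom z.1 (g z.2))) => h.
have /choice[c cP] t := gP (eval_at (delta S t) h).
exists (fun z => c z.1 z.2); rewrite -(pair_bigA _ (fun i j => c i j *: coord_hom i (g j))) /=.
rewrite -[LHS]sum_coord_eval; apply: eq_bigr => t _; rewrite cP linear_sum.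
by apply: eq_bigr => j _; rewrite linearZ.
Qed.

Lemma ext_dual_zero a :
  zero_mod (Ext U a.+1 (lside U)) -> zero_mod (Ext U a.+1 (Hom (swap U) F)).
Proof.
move=> /ext_res_zeroP z; apply/ext_res_zeroP.
exact: ext_zero_summand sum_coord_eval z.
Qed.

End FiniteFreeDual.

(** * Modules of large grade *)

Section HomFree.
Variables (R S : pzRingType) (U : bimodule R S) (T : choiceType).

Lemma hom_free_ext (h h' : Hom U (free_mod R T)) :
  (forall t, val h (delta R t) = val h' (delta R t)) -> h = h'.
Proof.
move=> e; apply: hom_ext => x; rewrite (lift_uniq (lin_of h)) (lift_uniq (lin_of h')).
by congr (lift _ x); apply/funext.
Qed.

(* Hom(free_mod R T, U) is U^T, so coefficients in it can be treated           *)
(* coordinatewise, even for infinite T.                                       *)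
Lemma ext_zero_hom_free (A : lmodType S) (P : proj_resolution A) n :
  ext_zero P (rside U) n -> ext_zero P (Hom U (free_mod R T)) n.
Proof.
have lev x : linear (fun h : Hom U (free_mod R T) => val h x : rside U) by exact: hom_eval_linear.
case: n => [|n] z c.
  move=> y; apply: hom_free_ext => t; exact: (z (mk_linear (lev (delta R t)) \o c)).
move=> c0; have /choice[b bP] t : exists b : {linear res_obj P n -> rside U},
    forall x, val (c x) (delta R t) = b (res_diff P n x).
  by apply: (z (mk_linear (lev (delta R t)) \o c)) => x; rewrite /= c0.
pose b' y := hom_of (U := U) (lift (fun t => b t y : lside U)).
have b'E y t : val (b' y) (delta R t) = b t y.
  exact: (lift_delta (A := lside U) (fun t => b t y) t).
have lb : linear b'.
  move=> s x y; apply: hom_free_ext => t; rewrite b'E linearP.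
  by rewrite [RHS](lev (delta R t)) !b'E.
exists (mk_linear lb) => x; apply: hom_free_ext => t.
by rewrite bP; exact/esym/b'E.
Qed.

End HomFree.

Section Chase.
Variables (S : pzRingType) (A : lmodType S) (F : proj_resolution A).
Variables (D : nat -> lmodType S) (d : forall t, {linear D t -> D t.+1}).

Definition boundary t : D t -> Prop :=
  match t with
  | 0 => fun w => w = 0
  | t'.+1 => fun w => exists v, d t' v = w
  end.

Variable g : nat.
Hypothesis dd : forall t x, d t.+1 (d t x) = 0.
Hypothesis exactD : forall t, (t < g)%N -> forall w, d t w = 0 -> boundary w.
Hypothesis zeroD : forall j t, (j <= g)%N -> ext_zero F (D t) j.

Lemma boundary_cycle t (w : D t) : boundary w -> d t w = 0.
Proof. by case: t w => [w ->|t w [v <-]]; rewrite ?linear0 ?dd. Qed.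

Lemma chase_step (L : lmodType S) t j (c : {linear res_obj F j -> D t.+1}) :
  projective L -> forall f : {linear L -> res_obj F j},
  (forall x, boundary (c (f x))) ->
  exists c' : {linear L -> D t}, forall x, d t (c' x) = c (f x).
Proof. by move=> pL f; apply: (projective_lift (f := c \o f)). Qed.

(** In substance Ext^(j+1)(A, D_t / im d) = 0, with the quotient replaced by lifts to D_t. Exactness
    embeds D_t / im d in D_(t+1), and induction on t shifts dimension along these embeddings. *)
Lemma chase t j (c : {linear res_obj F j.+1 -> D t}) :
  (j.+1 + t <= g)%N -> (forall x, boundary (c (res_diff F j.+1 x))) ->
  exists b : {linear res_obj F j -> D t}, forall x, boundary (c x - b (res_diff F j x)).
Proof.
elim: t j c => [|t IH] j c jt cb.
  have [|b bP] := @zeroD j.+1 0 _ c cb; first by rewrite -[j.+1]addn0.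
  by exists b => x; rewrite /= bP subrr.
have [c' c'P] := chase_step (@res_proj _ _ F j.+2) cb.
have [||b bP] := IH j.+1 c'; first by rewrite addSnnS.
  move=> x; apply: exactD.
    by apply: leq_trans jt; rewrite addnS ltnS leq_addl.
  by rewrite c'P res_diff_diff linear0.
have [||b' b'P] := @zeroD j.+1 t.+1 _ (c \- (d t \o b)).
- by apply: leq_trans jt; rewrite leq_addr.
- move=> x; have := boundary_cycle (bP x); rewrite linearB => /subr0_eq e.
  by rewrite /= -c'P e subrr.
by exists b' => x; exists (b x); rewrite -b'P /= opprB addrC subrK.
Qed.

(** The degree 0 end of the same shift: Hom(A, D_g / im d) = 0. *)
Lemma chase0 (c : {linear res_obj F 0 -> D g}) :
  (forall x, boundary (c (res_diff F 0 x))) -> forall x, boundary (c x).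
Proof.
have factor0 t (k : {linear res_obj F 0 -> D t}) :
    (forall x, k (res_diff F 0 x) = 0) -> forall x, k x = 0.
  move=> k0; have [k' k'P] : exists k' : {linear A -> D t}, forall x, k' (res_aug F x) = k x.
    apply: factor_surj => [|x /(iffLR (@res_exact0 _ _ F _))[y <-] //].
    exact: res_aug_surj.
  by move=> x; rewrite -k'P (@zeroD 0 t).
(* The section hypotheses mention [g], so the case split is made on an equal copy. *)
have gE : exists h, h = g by exists g.
case: gE => -[|h] hg; rewrite -hg in c *; first exact: factor0.
move=> cb x; have [c' c'P] := chase_step (@res_proj _ _ F 1) cb.
have [||b bP] := chase (t := h) (j := 0) (c := c').
- by rewrite add1n hg.
- by move=> y; apply: exactD; rewrite -?hg // c'P res_diff_diff linear0.
exists (b x); apply/esym/subr0_eq; apply: (factor0 _ (c \- (d h \o b))) => y.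
have := boundary_cycle (bP y); rewrite linearB => /subr0_eq e.
by rewrite /= -c'P e subrr.
Qed.

End Chase.

(** Maps from a projective into cohomology lift to cocycles. In degree 0, where [Ext_res] is
    Hom(X,U) itself, composing with the augmentation plays this role. *)
Lemma ext_cocycle (R S : pzRingType) (U : bimodule R S) (X : lmodType R)
    (P : proj_resolution X) g (L : lmodType S) (a : {linear L -> Ext_res U P g}) :
  projective L ->
  exists c : {linear L -> Hom U (res_obj P g)},
    forall x, a x = 0 <->
      boundary (D := fun t => Hom U (res_obj P t)) (fun t => precomp U (res_diff P t)) (c x).
Proof.
case: g a => [|g] a pL.
  exists (precomp U (res_aug P) \o a) => x /=; split=> [->|e]; first exact: linear0.
  apply: hom_ext => y; have [y' <-] := @res_aug_surj _ _ P y.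
  by rewrite -precompE e.
pose Z := kernel (precomp U (res_diff P g.+1)).
pose q := quot_proj (Submodule
  (boundary_closed (precomp U (res_diff P g)) (precomp U (res_diff P g.+1)))).
have [k kP] : exists k : {linear L -> submod Z}, forall x, q (k x) = a x.
  by apply: projective_lift => // x; exact: quot_proj_surj.
exists (submod_incl Z \o k) => x; rewrite -kP; split=> [/quot_proj_eq0/asboolP //|e].
exact/quot_proj_eq0/asboolP.
Qed.

Lemma ext_grade_zero (R S : pzRingType) (U : bimodule R S) (X : lmodType R) g :
  grade_ge U X g -> grade_ge (swap U) (Ext U g X) g.+1 -> zero_mod (Ext U g X).
Proof.
move=> gX gE; pose P := free_resolution X; pose F := free_resolution (Ext U g X).
pose D t : lmodType S := Hom U (res_obj P t).
pose d t : {linear D t -> D t.+1} := precomp U (res_diff P t).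
have dd t x : d t.+1 (d t x) = 0.
  by apply: hom_ext => y; rewrite !precompE res_diff_diff linear0.
have eD t : (t < g)%N -> forall w, d t w = 0 -> boundary d w.
  move=> /gX; case: t => [|t] z w w0; last exact: (iffLR (homology_zeroP _ _) z w w0).
  have [k kP] : exists k : {linear X -> lside U}, forall x, k (res_aug P x) = lin_of w x.
    apply: factor_surj => [|x /(iffLR (@res_exact0 _ _ P _))[y <-]].
      exact: res_aug_surj.
    by rewrite -precompE w0.
  by apply: hom_ext => x; rewrite -kP (iffLR (hom_zeroP U X) z k).
(* D_t is a possibly infinite power of U, so the grade of E applies to it coordinatewise. *)
have zD j t : (j <= g)%N -> ext_zero F (D t) j.
  by move=> /gE /ext_res_zeroP; exact: ext_zero_hom_free.
have ch := chase0 dd eD zD.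
have [c cP] := ext_cocycle (P := P) (res_aug F) (@res_proj _ _ F 0).
(* [c] represents the augmentation of [F], whose composite with the differential vanishes. The chase
   makes all of [c] a boundary, so the surjective augmentation is zero. *)
by move=> e; have [y <-] := @res_aug_surj _ _ F e; apply/cP/ch => x; apply/cP/res_aug_diff.
Qed.

(** * The dual of a finite free resolution *)

Lemma homology_sequence (R : pzRingType) (A B C : lmodType R)
    (f : {linear A -> B}) (g : {linear B -> C}) :
  (forall x, g (f x) = 0) ->
  exists (i : {linear homology f g -> quotmod (image_sub f)})
    (p : {linear quotmod (image_sub f) -> submod (image_sub g)}),
    [/\ injective i, surjective p, exact_at i p &
        forall e, exists2 z, g z = 0 & i e = quot_proj (image_sub f) z].
Proof.
move=> gf; pose q := quot_proj (image_sub f).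
have qs : surjective q by exact: quot_proj_surj.
have [g' g'P] : exists g' : {linear B -> submod (image_sub g)}, forall x, val (g' x) = g x.
  apply: (@factor_inj _ _ _ _ (submod_incl (image_sub g))) => [|x]; first exact: val_inj.
  by exists (exist _ (g x) (asboolT (ex_intro _ x erefl))).
have g'0 x : g' x = 0 <-> g x = 0.
  by split=> [e|e]; [rewrite -g'P e | apply: val_inj; rewrite g'P].
have [p pP] : exists p : {linear quotmod (image_sub f) -> submod (image_sub g)},
    forall x, p (q x) = g' x.
  apply: factor_surj => // x /quot_proj_eq0/asboolP[a <-].
  exact/g'0.
pose h := quot_proj (Submodule (boundary_closed f g)).
have hs : surjective h by exact: quot_proj_surj.
have hq z : h z = 0 <-> q (val z) = 0 by rewrite !quot_proj_eq0.
have [i iP] : exists i : {linear homology f g -> quotmod (image_sub f)},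
    forall z, i (h z) = q (val z).
  by apply: (@factor_surj _ _ _ _ h (q \o submod_incl (kernel g))) => // z /hq.
exists i, p; split.
- by apply: linear_injective => e; have [z <-] := hs e; rewrite iP => /hq.
- move=> y; have /asboolP[x xP] := valP y; exists (q x); rewrite pP.
  by apply: val_inj; rewrite g'P.
- move=> y; have [x <-] := qs y; rewrite pP g'0; split=> [gx|[e]].
    by exists (h (exist _ x (introT eqP gx))); rewrite iP.
  have [z <-] := hs e; rewrite iP => zx.
  have /quot_proj_eq0/asboolP[a aP] : q (x - val z) = 0 by rewrite linearB zx subrr.
  have /eqP gz := valP z.
  by rewrite -[x](subrK (val z)) -aP linearD gf gz addr0.
- move=> e; have [z <-] := hs e; exists (val z); last exact: iP.
  exact/eqP/(valP z).
Qed.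

Section DualComplex.
Variables (R S : pzRingType) (U : bimodule R S).
Hypothesis balanced : bijective (homothety (swap U)).
Hypothesis U_ext : forall a, zero_mod (Ext U a.+1 (lside U)).
Variables (N : lmodType S) (Q : proj_resolution N).
Hypothesis Q_free : forall n, finite_free (res_obj Q n).

Notation C m := (Hom (swap U) (res_obj Q m)).
Notation d m := (precomp (swap U) (res_diff Q m)).
Notation Y m := (quotmod (image_sub (d m))).
Notation B m := (submod (image_sub (d m))).
Notation H m := (Ext_res (swap U) Q m).

Lemma dual_d_d m x : d m.+1 (d m x) = 0.
Proof.
by apply: (@hom_ext _ _ (swap U)) => y; rewrite !precompE res_diff_diff linear0.
Qed.

Lemma dual_ext_zero m a : zero_mod (Ext U a.+1 (C m)).
Proof. by have [n ->] := Q_free m; exact: ext_dual_zero. Qed.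

(** By balance [phi] is evaluation at some [q]. Vanishing on boundaries makes [q] a cycle, since
    functionals into U separate points of a finite free module; exactness of [Q] then writes [q] as
    a boundary. *)
Lemma dual_functional m (phi : {linear C m.+1 -> lside U}) :
  (forall x, phi (d m x) = 0) ->
  exists q, forall h, phi h = val (d m.+1 h) q.
Proof.
move=> phi0; have [q qP] : exists q, forall h, phi h = val h q.
  have := Q_free m.+1; case=> n e; move: phi {phi0}; rewrite e => phi.
  exact: free_bidual_surj.
have /(iffLR (@res_exact _ _ Q m q))[q' q'P] : res_diff Q m q = 0.
  have inj (z : res_obj Q m) : (forall h : C m, val h z = 0) -> z = 0.
    have := Q_free m; case=> n e; move: z; rewrite e => z; exact: free_bidual_inj.
  by apply: inj => h; rewrite -[LHS]/(val (d m h) q) -qP phi0.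
by exists q' => h; rewrite qP -q'P.
Qed.

Lemma coker_exact m : exact_at (submod_incl (image_sub (d m))) (quot_proj (image_sub (d m))).
Proof.
move=> y; rewrite quot_proj_eq0; split=> [e|[x <-]]; last exact: (valP x).
by exists (exist _ y e).
Qed.

(** The case a = 0 holds because every functional on B m extends to C m.+1 as an evaluation. Higher
    degrees descend along 0 -> B m -> C m.+1 -> Y m -> 0 and 0 -> H m -> Y m.-1 -> B m -> 0, where
    the grade of H m provides the missing vanishing. *)
Lemma coker_ext_zero K m a :
  (forall j, (1 <= j <= K)%N -> grade_ge U (H j.+1) j) ->
  (m <= K.+1)%N -> (a < m)%N -> zero_mod (Ext U a.+1 (Y m)).
Proof.
move=> gH; elim: a m => [|a IH] [//|m] mK am.
  apply: (ext1_zero_quotient (i := submod_incl (image_sub (d m.+1)))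
    (p := quot_proj (image_sub (d m.+1)))); last exact: dual_ext_zero.
  - exact: val_inj.
  - exact: quot_proj_surj.
  - exact: coker_exact.
  move=> k; have [c cP] : exists c : {linear C m.+1 -> B m.+1}, forall x, val (c x) = d m.+1 x.
    apply: (@factor_inj _ _ _ _ (submod_incl (image_sub (d m.+1)))) => [|x]; first exact: val_inj.
    by exists (exist _ (d m.+1 x) (asboolT (ex_intro _ x erefl))).
  have [|q qP] := @dual_functional m (k \o c).
    move=> x; rewrite /= [c _](_ : _ = 0) ?linear0 //; apply: val_inj.
    by rewrite cP dual_d_d.
  exists (mk_linear (@hom_eval_linear _ _ (swap U) _ q)) => b.
  have /asboolP[h hP] := valP b; have -> : b = c h by apply: val_inj; rewrite cP.
  by rewrite [RHS]qP -cP.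
apply: (extS_zero_quotient (i := submod_incl (image_sub (d m.+1)))
  (p := quot_proj (image_sub (d m.+1)))); last exact: dual_ext_zero.
- exact: val_inj.
- exact: quot_proj_surj.
- exact: coker_exact.
have [i [p [ii ps ip _]]] := homology_sequence (@dual_d_d m).
apply: (extS_zero_quotient ii ps ip); last by apply: IH => //; exact: ltnW.
apply: (gH m); last exact: am.
by apply/andP; split; [exact: leq_ltn_trans (leq0n a) am | exact: mK].
Qed.

(** Both connecting maps pass through Ext^(g+1)(B g.+2, U): one comes from 0 -> H g.+2 -> Y g.+1 ->
    B g.+2 -> 0, the other from 0 -> B g.+2 -> C g.+3 -> Y g.+2 -> 0. *)
Lemma ext_ext_isomorphic g :
  (forall j, (1 <= j <= g)%N -> grade_ge U (H j.+1) j) ->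
  isomorphic (Ext U g (H g.+2)) (Ext U g.+2 (Y g.+2)).
Proof.
move=> gH; apply: (@isomorphic_trans _ _ (Ext U g.+1 (B g.+2))); last first.
  apply: (connecting_isomorphicS (i := submod_incl (image_sub (d g.+2)))
    (p := quot_proj (image_sub (d g.+2)))); try exact: dual_ext_zero.
  - exact: val_inj.
  - exact: quot_proj_surj.
  - exact: coker_exact.
have [i [p [ii ps ip iz]]] := homology_sequence (@dual_d_d g.+1).
case: g gH i p ii ps ip iz => [|g] gH i p ii ps ip iz; last first.
  by apply: (connecting_isomorphicS ii ps ip); apply: (coker_ext_zero gH).
apply: (connecting_isomorphic0 ii ps ip); last exact: (coker_ext_zero gH).
(* For g = 0 the connecting map starts at Hom, so functionals on Y 1 must vanish on H 2. They factor
   through the differential d 2, which kills the cocycles representing H 2. *)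
move=> k e; have [z z0 ->] := iz e.
have [|q qP] := @dual_functional 1 (k \o quot_proj (image_sub (d 1))).
  move=> x; have /= -> : quot_proj (image_sub (d 1)) (d 1 x) = 0; last exact: linear0.
  by apply/quot_proj_eq0/asboolP; exists x.
by rewrite [LHS]qP z0.
Qed.

Lemma fin_gen_coker m : fin_gen (lside U) -> fin_gen (Y m).
Proof.
move=> fgU; apply: (fin_gen_surj (f := quot_proj (image_sub (d m)))).
  exact: quot_proj_surj.
by have [n ->] := Q_free m.+1; exact: fin_gen_dual.
Qed.

End DualComplex.

(** * Passage between the two sides and the equivalence *)

Lemma grade_transfer (R S : pzRingType) (U : bimodule R S) (K : nat) :
  left_noetherian S -> fin_gen (lside U) -> bijective (homothety (swap U)) ->
  (forall a, zero_mod (Ext U a.+1 (lside U))) ->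
  (forall M : lmodType R, fin_gen M ->
    forall i, (1 <= i <= K)%N -> grade_ge (swap U) (Ext U i.+1 M) i) ->
  forall N : lmodType S, fin_gen N ->
    forall i, (1 <= i <= K)%N -> grade_ge U (Ext (swap U) i.+1 N) i.
Proof.
move=> nS fgU balU zU gM.
suff main g : (g <= K)%N -> forall N : lmodType S, fin_gen N ->
    forall i, (1 <= i <= g)%N -> grade_ge U (Ext (swap U) i.+1 N) i.
  exact: main.
elim: g => [|g IH] gK N fgN i; first by case: i.
move=> /andP[i0]; rewrite leq_eqVlt => /orP[/eqP->|ig]; last first.
  by apply: (IH (ltnW gK)) => //; rewrite i0.
have [Q Qf] := finite_free_resolution nS fgN.
have gH j : (1 <= j <= g)%N -> grade_ge U (Ext_res (swap U) Q j.+1) j.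
  move=> /(IH (ltnW gK) N fgN); apply: grade_ge_isomorphic.
  exact/isomorphic_sym/ext_res_ext.
apply: (grade_ge_isomorphic (ext_res_ext (swap U) Q g.+2)).
set X := Ext_res _ _ _.
(* X is also Ext^(g+1) of the first syzygy of N, to which the induction hypothesis applies at i = g.
   For g = 0 the bound is vacuous. *)
have gX : grade_ge U X g.
  case: (posnP g) => [-> //|g0].
  have := IH (ltnW gK) _ (fin_gen_res_syz (Qf 1)) g; rewrite g0 leqnn => /(_ isT).
  apply: grade_ge_isomorphic; apply: isomorphic_trans (ext_syz _ _ _) _.
  exact/isomorphic_sym/ext_res_ext.
move=> j; rewrite ltnS leq_eqVlt => /orP[/eqP->|]; last exact: gX.
apply: ext_grade_zero => //.
(* E is Ext^(g+2) of a finitely generated R-module, so the assumption [gM] at i = g+1 bounds its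
   grade. *)
apply: (grade_ge_isomorphic (isomorphic_sym (ext_ext_isomorphic balU zU Qf gH))).
apply: gM; last by [].
exact: fin_gen_coker.
Qed.

(** The top degree is the assumption; all lower degrees come from the induction hypothesis at the
    syzygy, whose finite generation uses that R is noetherian. *)
Lemma grade_of_ext_zero (R S : pzRingType) (U : bimodule R S) (K : nat) :
  left_noetherian R ->
  (forall M : lmodType R, fin_gen M ->
    forall i, (1 <= i <= K)%N -> zero_mod (Ext (swap U) (i - 1)%N (Ext U i.+1 M))) ->
  forall M : lmodType R, fin_gen M ->
    forall i, (1 <= i <= K)%N -> grade_ge (swap U) (Ext U i.+1 M) i.
Proof.
move=> nR z M fgM i; elim: i M fgM => [//|i IH] M fgM iK j.
rewrite ltnS leq_eqVlt => /orP[/eqP->|ji].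
  by have := z M fgM _ iK; rewrite subn1.
have [P Pf] := finite_free_resolution nR fgM.
have i0 : (1 <= i <= K)%N by rewrite (leq_ltn_trans _ ji) // ltnW.
have := IH _ (fin_gen_res_syz (Pf 1)) i0 _ ji.
exact/isomorphic_zero/ext_isomorphic/ext_syz.
Qed.

Lemma swapK (R S : pzRingType) (U : bimodule R S) : swap (swap U) = U.
Proof. by case: U => *; congr Bimodule; exact: Prop_irrelevance. Qed.

Theorem lemma3p3 (Lambda Gamma : pzRingType)
    (U : bimodule Lambda Gamma^c) (k : nat) :
  left_noetherian Lambda -> right_noetherian Lambda ->
  left_noetherian Gamma -> right_noetherian Gamma ->
  faithfully_balanced U -> selforthogonal U ->
  fin_gen (lside U) -> fin_gen (rside U) ->
  (0 < k)%N ->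
  [<->
    forall M : lmodType Lambda, fin_gen M ->
      forall i, (1 <= i <= k - 1)%N -> grade_ge (swap U) (Ext U i.+1 M) i;
    forall M : lmodType Lambda, fin_gen M ->
      forall i, (1 <= i <= k - 1)%N ->
        zero_mod (Ext (swap U) (i - 1)%N (Ext U i.+1 M));
    forall N : lmodType Gamma^c, fin_gen N ->
      forall i, (1 <= i <= k - 1)%N -> grade_ge U (Ext (swap U) i.+1 N) i;
    forall N : lmodType Gamma^c, fin_gen N ->
      forall i, (1 <= i <= k - 1)%N ->
        zero_mod (Ext U (i - 1)%N (Ext (swap U) i.+1 N))].
Proof.
move=> nL _ _ nG [balG balL] orthU fgL fgG _.
have grade_last (R S : pzRingType) (V : bimodule R S) A i :
    (1 <= i <= k - 1)%N -> grade_ge V A i -> zero_mod (Ext V (i - 1)%N A).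
  by move=> /andP[i0 _]; apply; rewrite subn1 prednK.
tfae.
- by move=> gM M fgM i ik; apply: grade_last => //; exact: gM.
(* The cycle closes through the grade conditions: each single-degree condition first gives the grade
   condition on its own side, then crosses to the other. *)
- move=> /(grade_of_ext_zero nL); apply: grade_transfer => // a.
  by have [] := orthU a.+1 isT.
- by move=> gN N fgN i ik; apply: grade_last => //; exact: gN.
- have := @grade_transfer _ _ (swap U) (k - 1) nL fgG.
  have := @grade_of_ext_zero _ _ (swap U) (k - 1) nG.
  rewrite swapK => grade transfer zN; apply: transfer (grade zN) => // a.
  by have [] := orthU a.+1 isT.
Qed.
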